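(* Let $P$ be a forest poset on $\{x_1,\ldots,x_n\}$, let $k$ be a field, $S=k[x_1,\ldots,x_n]$, and let $t\geq 2$ be an integer. Then $S/I_t(P)$ is sequentially Cohen–Macaulay.
   Context: The Hasse diagram of a poset $P$ has the elements of $P$ as vertices and an edge from $x$ to $y$ whenever $y$ covers $x$. A pencil is a poset whose elements can be written as a disjoint union $\{x_1,\ldots,x_r\}\cup\{z\}\cup\{y_1,\ldots,y_m\}$ with $r,m\geq 2$ such that $x_i<z<y_j$ for all $i,j$, and the sets $\{x_1,\ldots,x_r\}$ and $\{y_1,\ldots,y_m\}$ are both antichains. A poset is a tree (poset) if its Hasse diagram is a tree as an undirected graph and it does not contain any pencil as a subposet. A forest (poset) is a disjoint union of tree posets. The elements of $P$ are identified with the variables of $S$. A path of length $t$ in $P$ is a saturated chain of $t$ elements (each element covers the previous one). The path ideal is $I_t(P)=\langle x_{i_1}\cdots x_{i_t} : x_{i_1},\ldots,x_{i_t}\text{ is a path of length } t\text{ in }P\rangle\subseteq S$. *)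

(* Defs.v *)
From mathcomp Require Import all_boot all_order all_algebra.
From mathcomp Require Import mpoly.

Set Implicit Arguments.
Unset Strict Implicit.
Unset Printing Implicit Defensive.

Import Order.TTheory GRing.Theory.

Section ForestPosets.
Context {disp : Order.disp_t} {P : finPOrderType disp}.
Local Open Scope order_scope.

(* A set A : {set P} stands for the subposet of P it carries, with the order
   induced by P; [covers A] is the covering relation of that subposet. *)
Definition covers (A : {set P}) (x y : P) : bool :=
  [&& x \in A, y \in A, x < y & [forall z in A, ~~ ((x < z) && (z < y))]].

Definition hasse (A : {set P}) : rel P :=
  fun x y => covers A x y || covers A y x.

Definition antichain (A : {set P}) : Prop :=
  {in A &, forall x y, x <= y -> x = y}.

(* The union X, {z}, Y is automatically disjoint since x < z < y. *)
Definition pencil (A : {set P}) : Prop :=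
  exists (X : {set P}) (z : P) (Y : {set P}),
    [/\ A = X :|: [set z] :|: Y,
        (1 < #|X|)%N /\ (1 < #|Y|)%N,
        {in X, forall x, x < z} /\ {in Y, forall y, z < y},
        antichain X & antichain Y].

(* For a symmetric irreflexive e, the ucycles of size at most 2 are degenerate
   (empty, or a single edge traversed both ways). *)
Definition graph_tree (A : {set P}) (e : rel P) : Prop :=
  [/\ A != set0,
      {in A &, forall x y, connect e x y}
    & forall c : seq P, {subset c <= A} -> ucycle e c -> (size c <= 2)%N].

Definition tree_poset (A : {set P}) : Prop :=
  graph_tree A (hasse A) /\ forall B : {set P}, B \subset A -> ~ pencil B.

Definition forest_poset : Prop :=
  exists Q : {set {set P}},
    [/\ partition Q [set: P],
        forall A : {set P}, A \in Q -> tree_poset A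
      & forall A B : {set P}, A \in Q -> B \in Q -> A != B ->
          {in A & B, forall x y, ~~ (x >=< y)}].

End ForestPosets.

Arguments forest_poset {disp} P.

Local Open Scope ring_scope.

(* Ideals are arbitrary (not necessarily decidable) predicates: the ideals of
   ring_quotient are boolean and always proper. *)
Section Ideals.
Context {R : comNzRingType}.
Implicit Types I J A B : R -> Prop.

Definition sub_ideal I J : Prop := forall f, I f -> J f.

Definition strict_sub_ideal I J : Prop := sub_ideal I J /\ ~ sub_ideal J I.

Definition is_ideal J : Prop :=
  [/\ J 0, forall f g, J f -> J g -> J (f + g) & forall a f, J f -> J (a * f)].

Definition prime_ideal J : Prop :=
  [/\ is_ideal J, ~ J 1 & forall f g, J (f * g) -> J f \/ J g].

Definition ideal_gen (G : R -> Prop) : R -> Prop :=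
  fun f => exists (m : nat) (a g : 'I_m -> R),
    (forall i, G (g i)) /\ f = \sum_(i < m) a i * g i.

Definition prime_chain J (d : nat) (p : nat -> R -> Prop) : Prop :=
  (forall i, (i <= d)%N -> prime_ideal (p i) /\ sub_ideal J (p i)) /\
  (forall i, (i < d)%N -> strict_sub_ideal (p i) (p i.+1)).

(* The Krull dimension of R / J is d. *)
Definition krull_dim J (d : nat) : Prop :=
  (exists p, prime_chain J d p) /\ (forall e p, prime_chain J e p -> (e <= d)%N).

(* Below, for ideals B contained in A, the pair (A, B) stands for the R-module
   M = A / B. *)
Definition annihilator A B : R -> Prop := fun f => forall a, A a -> B (f * a).

(* B + f A, so that M / f M = A / (B + f A). *)
Definition add_mul A B (f : R) : R -> Prop :=
  fun u => exists2 b, B b & exists2 a, A a & u = b + f * a.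

(* fs is an M-regular sequence; the base case says M / (fs) M != 0. *)
Fixpoint regular_seq A B (fs : seq R) : Prop :=
  if fs is f :: fs' then
    (forall a, A a -> B (f * a) -> B a) /\ regular_seq A (add_mul A B f) fs'
  else ~ sub_ideal A B.

(* The depth of M with respect to the ideal m is d. *)
Definition depth (m : R -> Prop) A B (d : nat) : Prop :=
  (exists fs, [/\ {in fs, forall f, m f}, regular_seq A B fs & size fs = d]) /\
  (forall fs, {in fs, forall f, m f} -> regular_seq A B fs -> (size fs <= d)%N).

Definition cohen_macaulay_of_dim (m : R -> Prop) A B (d : nat) : Prop :=
  krull_dim (annihilator A B) d /\ depth m A B d.

End Ideals.

Section SequentiallyCohenMacaulay.
Context {k : fieldType} {n : nat}.
Local Notation S := {mpoly k[n]}.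

Definition homogeneous_ideal (J : S -> Prop) : Prop :=
  is_ideal J /\ forall f, J f -> forall d : nat, J (pihomog [measure of mdeg] d f).

Definition irrelevant_ideal : S -> Prop :=
  ideal_gen (fun f => exists i : 'I_n, f = 'X_i).

(* S / I is sequentially Cohen-Macaulay: there is a finite filtration
   0 = M_0 < M_1 < ... < M_r = S / I by graded submodules, with Cohen-Macaulay
   quotients M_(i+1) / M_i of strictly increasing Krull dimensions.  The graded
   submodules of S / I are the J / I with J a homogeneous ideal containing I;
   hence M_i = J i / I and M_(i+1) / M_i = J i.+1 / J i. *)
Definition quotient_sequentially_cohen_macaulay (I : S -> Prop) : Prop :=
  exists (r : nat) (J : nat -> S -> Prop) (d : nat -> nat),
    [/\ forall f, J 0%N f <-> I f,
        forall f, J r f,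
        forall i, (i <= r)%N -> homogeneous_ideal (J i),
        forall i, (i < r)%N -> strict_sub_ideal (J i) (J i.+1) /\
          cohen_macaulay_of_dim irrelevant_ideal (J i.+1) (J i) (d i)
      & forall i, (i.+1 < r)%N -> (d i < d i.+1)%N].

End SequentiallyCohenMacaulay.

(* The variable attached to x : P is the one indexed by enum_rank x. *)
Section PathIdeals.
Context {disp : Order.disp_t} (P : finPOrderType disp) (k : fieldType).

Definition path_monomial (p : seq P) : {mpoly k[#|P|]} :=
  \prod_(x <- p) 'X_(enum_rank x).

Definition path_ideal (t : nat) : {mpoly k[#|P|]} -> Prop :=
  ideal_gen (fun f => exists p : seq P,
    [/\ size p = t, sorted (covers [set: P]) p & f = path_monomial p]).

End PathIdeals.

Arguments path_ideal {disp} P k t _.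

(* Main.v *)
(* Call a vertex v of a family of vertex sets (traced on a set W) a nest vertex
   if the traces of the members through v have a smallest one.  In a forest
   poset every nonempty set W has an element v that is maximal in W with a chain
   below it in W, or minimal in W with a chain above it in W; this is proved by
   removing leaves of the Hasse diagram.  As paths are convex chains, such a v
   is a nest vertex for any family of paths traced on W.

   Nest vertices allow one to shell recursively (in the nonpure sense) the
   complex D of the vertex sets that contain no path: D is a disjoint union of
   intervals [G, F], suitably ordered.  The squarefree monomial ideals of the
   subcomplexes of D covered by the intervals with |F| >= d filter S / I_t(P),
   and the d-th quotient is itself filtered by shifted copies of the polynomial
   rings k[F] with |F| = d.  On each of these the elementary symmetric
   polynomials e_d, ..., e_1 form a regular sequence, hence they do on the whole
   quotient.  Conversely, any d + 1 elements of S satisfy a nontrivial relation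
   modulo the annihilator of the quotient, by counting dimensions; this bounds
   both the Krull dimension and the depth by d. *)
Require Import Defs.
From Stdlib Require Import Classical.
From mathcomp Require Import all_boot all_order all_algebra.
From mathcomp Require Import mpoly ring.

Set Implicit Arguments.
Unset Strict Implicit.
Unset Printing Implicit Defensive.

Import Order.TTheory GRing.Theory.

(** * Shellings from nest vertices *)

Section Shelling.
Variable T : finType.
Implicit Types (a b : {set T} * {set T}) (s : {set T}) (L : seq ({set T} * {set T})).

Definition in_interval s a := (a.1 \subset s) && (s \subset a.2).

(* The intervals are pairwise compatible with the order of decreasing size of
   the top element, refined by the order of the list: in a before b, no member
   of b lies below a member of a. *)
Definition shell_rel a b :=
  ((#|b.2| <= #|a.2|) ==> ~~ (b.1 \subset a.2)) &&
  ((#|a.2| < #|b.2|) ==> ~~ (a.1 \subset b.2)).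

Definition shelling (D : pred {set T}) L :=
  [/\ all (fun a => a.1 \subset a.2) L, pairwise shell_rel L
    & forall s, D s = has (in_interval s) L].

(** The two halves of [shell_rel] serve the two possible orders of [a] and [b] in [L], so only the
    sizes of the tops matter. *)
Lemma pairwise_shell_lt L a b : pairwise shell_rel L -> a \in L -> b \in L ->
  #|b.2| < #|a.2| -> ~~ (b.1 \subset a.2).
Proof.
elim: L => //= c L IH /andP[/allP hc hL]; rewrite !inE.
case/orP=> [/eqP->|aL]; case/orP=> [/eqP->|bL] hlt.
- by rewrite ltnn in hlt.
- by case/andP: (hc _ bL) => /implyP h _; apply: h; apply: ltnW.
- by case/andP: (hc _ aL) => _ /implyP; apply.
- exact: IH.
Qed.

Variable E0 : {set {set T}}.

Hypothesis nest : forall (E : {set {set T}}) (W : {set T}),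
  E \subset E0 -> E != set0 -> (forall e, e \in E -> e :&: W != set0) ->
  exists v e1, [/\ v \in W, e1 \in E, v \in e1
    & forall e, e \in E -> v \in e -> e1 :&: W \subset e :&: W].

Definition independent (E : {set {set T}}) (W s : {set T}) :=
  (s \subset W) && [forall e in E, ~~ (e :&: W \subset s)].

(* With A the smallest trace through v, deprived of v: the faces without A are
   the faces of the trace on W - v, with v added freely; the faces containing A
   avoid v, and are the faces of the link of A. *)
Lemma independent_shelling (E : {set {set T}}) (W : {set T}) :
  E \subset E0 -> exists L, shelling (independent E W) L.
Proof.
have [N] := ubnP #|W|; elim: N => // N IH in E W *; rewrite ltnS => leN EE0.
have [->|En0] := eqVneq E set0.
  exists [:: (set0, W)]; split; rewrite /= ?sub0set // => s.
  rewrite /independent /in_interval /= sub0set orbF andbC.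
  case: (s \subset W); rewrite ?andbF // andbT.
  by apply/forall_inP => e; rewrite inE.
have [/existsP[e /andP[eE /eqP e0]]|hE] := boolP [exists e in E, e :&: W == set0].
  exists [::]; split => // s; rewrite /independent /=.
  apply/negbTE; rewrite negb_and; apply/orP; right; apply/negP => /forall_inP.
  by move/(_ e eE); rewrite e0 sub0set.
have {}hE e : e \in E -> e :&: W != set0.
  by move=> eE; apply: contra hE => h; apply/existsP; exists e; rewrite eE.
have [v [e1 [vW e1E ve1 min1]]] := nest EE0 En0 hE.
set A := e1 :&: W :\ v.
set W1 := W :\ v; set W2 := W :\: e1.
set E2 := [set e in E | v \notin e].
have vA : v \notin A by rewrite !inE eqxx.
have AE : A = e1 :&: W1 by rewrite /A setIDA.
have cW1 : #|W1| < N by rewrite (cardsD1 v W) vW in leN.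
have cW2 : #|W2| < N.
  apply: leq_ltn_trans cW1; apply: subset_leq_card; apply/subsetP => x.
  by rewrite !inE; case: eqVneq => [->|]; rewrite ?ve1 // => _ /andP[].
have [L1 [/allP sub1 pw1 cov1]] := IH _ _ cW1 EE0.
have [L2 [/allP sub2 pw2 cov2]] : exists L, shelling (independent E2 W2) L.
  by apply: IH => //; apply: subset_trans EE0; apply/subsetP => x; rewrite inE => /andP[].
have F1 a : a \in L1 -> [/\ a.1 \subset a.2, a.2 \subset W1, v \notin a.2 & ~~ (A \subset a.2)].
  move=> aL; have s1 := sub1 _ aL.
  have : independent E W1 a.2.
    by rewrite cov1; apply/hasP; exists a => //; rewrite /in_interval s1 subxx.
  case/andP=> s2 /forall_inP /(_ _ e1E); rewrite -AE => nA; split => //.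
  by apply/negP => /(subsetP s2); rewrite !inE eqxx.
have F2 a : a \in L2 -> [/\ a.1 \subset a.2, a.2 \subset W2 & independent E2 W2 a.2].
  move=> aL; have s1 := sub2 _ aL.
  have i2 : independent E2 W2 a.2.
    by rewrite cov2; apply/hasP; exists a => //; rewrite /in_interval s1 subxx.
  by split => //; case/andP: i2.
have c1 a : a \in L1 -> #|v |: a.2| = #|a.2|.+1.
  by case/F1 => _ _ va _; rewrite cardsU1 va.
have AW2 : A :&: W2 = set0 by apply/setP => x; rewrite !inE; case: (x \in e1); rewrite ?andbF.
have c2 a : a \in L2 -> #|A :|: a.2| = #|A| + #|a.2|.
  case/F2 => _ h _; rewrite cardsU (_ : A :&: a.2 = set0) ?cards0 ?subn0 //.
  by apply/eqP; rewrite -subset0 -AW2 setIS.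
have disj a x : a \in L2 -> x \in a.2 -> (x \in A) = false.
  case/F2 => _ h _ xa; apply/negbTE/negP => xA.
  by move: (in_set0 x); rewrite -AW2 inE xA (subsetP h _ xa).
exists ([seq (a.1, v |: a.2) | a <- L1] ++ [seq (A :|: a.1, A :|: a.2) | a <- L2]).
split.
- rewrite all_cat !all_map; apply/andP; split; apply/allP => a aL /=.
    by case: (F1 _ aL) => h *; apply: subset_trans h (subsetUr _ _).
  by case: (F2 _ aL) => h *; apply: setUS.
- rewrite pairwise_cat !pairwise_map; apply/and3P; split.
  + apply/allrelP => _ _ /mapP[a aL ->] /mapP[b bL ->]; rewrite /shell_rel /=.
    have [ga fa va nA] := F1 _ aL; have [gb fb ib] := F2 _ bL.
    apply/andP; split; apply/implyP.
      move=> _; apply/negP => h; case/negP: nA.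
      apply/subsetP => x xA; have : x \in v |: a.2 by apply: (subsetP h); rewrite inE xA.
      by rewrite !inE; case: eqVneq => // xv; rewrite xv (negbTE vA) in xA.
    (* Suppose [a.1] lies in [A :|: b.2]. It misses some [w] of [A], and the face [(A :|: b.2) :\ w]
       lies in an interval [c] of [L1] whose top is larger than [a.2] and contains [a.1], against
       the order of [L1]. *)
    rewrite c1 // c2 // => hlt; apply/negP => hG.
    have nAG : ~~ (A \subset a.1).
      by apply: contra nA => h; apply: subset_trans h ga.
    have [w wA wG] := subsetPn nAG.
    (* A member through [v] has [w] in its trace, by minimality of [e1]; any other one would have
       its trace on [W2] inside [b.2]. *)
    have i1 : independent E W1 ((A :|: b.2) :\ w).
      case/andP: ib => _ /forall_inP ib.
      apply/andP; split.
        apply/subsetP => x; rewrite in_setD1 in_setU => /andP[_].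
        case/orP=> [|/(subsetP fb)]; first by rewrite AE inE => /andP[].
        rewrite !inE => /andP[xe1 ->]; rewrite andbT.
        by apply: contraNneq xe1 => ->.
      apply/forall_inP => e eE; apply/negP => h.
      have [ve|ve] := boolP (v \in e).
        have := subsetP (min1 _ eE ve) w; move: wA; rewrite !inE.
        move=> /and3P[wv we1 wW]; rewrite we1 wW => /(_ isT) /andP[we _].
        by have := subsetP h w; rewrite !inE we wv wW eqxx => /(_ isT).
      have eE2 : e \in E2 by rewrite inE eE.
      case/negP: (ib _ eE2); apply/subsetP => x; rewrite !inE => /and3P[xe xe1 xW].
      have := subsetP h x; rewrite !inE xe xW (negbTE xe1) /= andbT.
      have -> : x != v by apply: contraNneq ve => <-.
      by case/(_ isT)/andP.
    move: i1; rewrite cov1 => /hasP[c cL /andP[c1s c2s]].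
    have cc : #|A :|: b.2| = #|(A :|: b.2) :\ w|.+1.
      by rewrite (cardsD1 w (A :|: b.2)) inE wA.
    have := subset_leq_card c2s; rewrite -ltnS -cc c2 // => hle.
    have hac : #|a.2| < #|c.2| by rewrite -ltnS; apply: leq_trans hlt hle.
    case/negP: (pairwise_shell_lt pw1 cL aL hac).
    apply: subset_trans c2s; apply/subsetP => x xa; rewrite in_setD1.
    by rewrite (subsetP hG _ xa) andbT; apply: contraNneq wG => <-.
  + apply: (sub_in_pairwise (P := mem L1)) (allss _) pw1; move=> a b aL bL /=; rewrite /shell_rel /= !c1 //.
    have [ga fa va nA] := F1 _ aL; have [gb fb vb nB] := F1 _ bL.
    have key (c d : {set T}) : v \notin c -> (c \subset v |: d) = (c \subset d) :> bool.
      move=> vc; apply/idP/idP => [/subsetP h|/subset_trans]; last by apply; apply: subsetUr.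
      apply/subsetP => x xc; move: (h _ xc); rewrite !inE.
      by case: eqVneq => // xv; rewrite -xv xc in vc.
    have na : v \notin a.1 by apply: contra va => /(subsetP ga).
    have nb : v \notin b.1 by apply: contra vb => /(subsetP gb).
    by rewrite !key.
  + apply: (sub_in_pairwise (P := mem L2)) (allss _) pw2; move=> a b aL bL /=; rewrite /shell_rel /= !c2 //.
    have [ga fa _] := F2 _ aL; have [gb fb _] := F2 _ bL.
    rewrite leq_add2l ltn_add2l.
    have key c (d : {set T}) : c \in L2 -> (A :|: c.1 \subset A :|: d) = (c.1 \subset d) :> bool.
      move=> cL; apply/idP/idP => [/subsetP h|]; last exact: setUS.
      apply/subsetP => x xc; have := h x; rewrite !in_setU xc orbT => /(_ isT).
      by rewrite (disj c x) //; case: (F2 _ cL) => /subsetP->.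
    by rewrite !key.
- move=> s; rewrite has_cat !has_map.
  (* A set containing [A] can only come from [L2], any other set only from [L1]; the recursive
     shellings then apply to [s :\: A] and [s :\ v]. *)
  have [As|As] := boolP (A \subset s).
    rewrite (eq_in_has (a2 := pred0)) ?has_pred0 /=; last first.
      move=> a aL /=; apply/negbTE; rewrite negb_and; apply/orP; right; apply/negP => /= h.
      have [_ _ _] := F1 _ aL; case/negP; apply/subsetP => x xA.
      have := subsetP h _ (subsetP As _ xA); rewrite !inE.
      by case: eqVneq => // xv; rewrite -xv xA in vA.
    rewrite (eq_in_has (a2 := in_interval (s :\: A))); last first.
      move=> a aL; rewrite /preim /in_interval /= subUset As /= subDset; congr (_ && _).
      apply/idP/idP => [h|]; last by move/subset_trans; apply; apply: subsetDl.
      apply/subsetP => x xa; rewrite inE (subsetP h _ xa) andbT.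
      by rewrite (disj a) //; case: (F2 _ aL) => /subsetP->.
    rewrite -cov2; apply/andP/andP => -[sW /forall_inP ind].
      (* Together with [A], the vertex [v] would complete the trace of [e1]. *)
      have vs : v \notin s.
        apply/negP => vs; case/negP: (ind _ e1E); apply/subsetP => x xe.
        have [->|xv] := eqVneq x v; first by [].
        by apply: (subsetP As); rewrite in_setD1 xv.
      split.
        apply/subsetP => x; rewrite !inE => /andP[nx xs].
        move: nx; rewrite (subsetP sW _ xs) !andbT.
        have -> : x != v by apply: contraNneq vs => <-.
        by rewrite /= => ->.
      apply/forall_inP => e; rewrite inE => /andP[eE ve]; apply/negP => h.
      case/negP: (ind _ eE); apply/subsetP => x; rewrite inE => /andP[xe xW].
      have [xe1|xe1] := boolP (x \in e1).
        apply: (subsetP As); rewrite !inE xe1 xW !andbT.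
        by apply: contraNneq ve => <-.
      by have := subsetP h x; rewrite !inE xe xW xe1 => /(_ isT) /andP[].
    have vs : v \notin s.
      apply/negP => vs; have := subsetP sW v; rewrite !inE vs ve1 eqxx /=.
      by move/(_ isT).
    split.
      apply/subsetP => x xs; have [xA|xA] := boolP (x \in A).
        by move: xA; rewrite !inE => /and3P[].
      by have := subsetP sW x; rewrite inE xA xs inE => /(_ isT) /andP[].
    apply/forall_inP => e eE; apply/negP => h.
    have ve : v \notin e.
      by apply: contra vs => ve; apply: (subsetP h); rewrite inE ve.
    have := ind e; rewrite inE eE ve => /(_ isT) /negP; apply.
    apply/subsetP => x; rewrite !inE => /and3P[xe xe1 xW].
    by rewrite (negbTE xe1) andbF /=; apply: (subsetP h); rewrite inE xe.
  rewrite orbC (eq_in_has (a2 := pred0)) ?has_pred0 /=; last first.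
    move=> a aL /=; apply/negbTE; rewrite negb_and; apply/orP; left.
    by apply: contra As => /= h; apply: subset_trans h; apply: subsetUl.
  rewrite (eq_in_has (a2 := in_interval (s :\ v))); last first.
    move=> a aL; rewrite /preim /in_interval /= subDset; congr (_ && _).
    apply/idP/idP => [h|]; last by move/subset_trans; apply; apply: subsetDl.
    apply/subsetP => x xa; rewrite inE (subsetP h _ xa) andbT inE.
    by apply: contraTneq xa => ->; have [/subsetP g _ va _] := F1 _ aL; apply: contra va => /g.
  rewrite -cov1; apply/andP/andP => -[sW /forall_inP ind]; split.
  + exact: setSD.
  + apply/forall_inP => e eE; apply/negP => h.
    have [ve|ve] := boolP (v \in e).
      case/negP: As; apply/subsetP => x xA.
      have : x \in s :\ v; last by rewrite !inE => /andP[].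
      apply: (subsetP h); move: xA; rewrite !inE => /and3P[xv xe1 xW].
      have := subsetP (min1 _ eE ve) x; rewrite !inE xe1 xW xv => /(_ isT).
      by case/andP => ->.
    case/negP: (ind _ eE); apply/subsetP => x; rewrite inE => /andP[xe xW].
    have xv : x != v by apply: contraNneq ve => <-.
    by have := subsetP h x; rewrite !inE xe xW xv /= => /(_ isT).
  + apply/subsetP => x xs; have [->//|xv] := eqVneq x v.
    by have := subsetP sW x; rewrite !inE xv xs => /(_ isT).
  + apply/forall_inP => e eE; apply: contra (ind _ eE) => h.
    apply/subsetP => x; rewrite !inE => /and3P[xe xv xW].
    by rewrite xv (subsetP h) // inE xe.
Qed.

End Shelling.

(** * Nest vertices in forest posets *)

Section AcyclicGraph.
Variables (T : finType) (e : rel T).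
Hypotheses (e_irr : irreflexive e) (e_sym : ssrbool.symmetric e).

(** Otherwise every vertex of [B] has two neighbours in [B], and a path can be prolonged at its head
    until it has more than [#|T|] vertices, since meeting itself would close a cycle. *)
Lemma acyclic_has_leaf (A B : {set T}) :
  (forall c : seq T, {subset c <= A} -> ucycle e c -> size c <= 2) ->
  B \subset A -> B != set0 ->
  exists2 x, x \in B & {in B &, forall y z, e x y -> e x z -> y = z}.
Proof.
move=> acyc BA Bn0.
have [/existsP[x /andP[xB /forall_inP h]]|/existsPn noleaf] := boolP [exists x, (x \in B) &&
    [forall y in B, forall z in B, e x y ==> e x z ==> (y == z)]].
  exists x => // y z yB zB exy exz; have /forall_inP /(_ z zB) := h y yB.
  by rewrite exy exz => /eqP.
have other x y : x \in B -> exists z, [/\ z \in B, e x z & z != y].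
  move=> xB; have := noleaf x; rewrite xB => /forall_inPn[z zB /forall_inPn[w wB]].
  rewrite !negb_imply => /and3P[exz exw zw].
  have [zy|zy] := eqVneq z y; last by exists z.
  by exists w; split => //; rewrite -zy eq_sym.
have long m : exists x y s, [/\ path e x (y :: s), uniq (x :: y :: s),
    {subset x :: y :: s <= B} & size s = m].
  elim: m => [|m [x [y [s [pth unq sub sz]]]]].
    have [x xB] := set0Pn _ Bn0; have [y [yB exy _]] := other x x xB.
    exists x, y, [::]; split => //=; first by rewrite exy.
      by rewrite inE andbT; apply: contraTneq exy => ->; rewrite e_irr.
    by move=> z; rewrite !inE => /orP[] /eqP->.
  have xB : x \in B by apply: sub; rewrite mem_head.
  have [w [wB exw wy]] := other x y xB.
  have wx : w != x by apply: contraTneq exw => ->; rewrite e_irr.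
  (* If [w] lies in [s], the stretch of the path from [x] to [w] closes up to a cycle of size at
     least 3. *)
  have [ws|ws] := boolP (w \in s).
    case/splitPr: ws pth unq sub sz => p1 p2 pth unq sub _.
    suff: size (x :: y :: rcons p1 w) <= 2 by rewrite /= size_rcons.
    apply: acyc => [z zc|].
      apply: (subsetP BA); apply: sub; move: zc; rewrite !inE mem_rcons mem_cat !inE.
      by move=> /or4P[->|->|->|->]; rewrite ?orbT.
    apply/andP; split.
      move: pth; rewrite /= -cat_rcons cat_path => /and3P[-> h _] /=.
      by rewrite rcons_path h last_rcons e_sym exw.
    by move: unq; rewrite -cat_rcons -!cat_cons cat_uniq => /andP[].
  exists w, x, (y :: s); split => //=.
  - by rewrite e_sym exw.
  - by rewrite !inE (negbTE wx) (negbTE wy) (negbTE ws).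
  - by move=> z; rewrite inE => /orP[/eqP->//|]; apply: sub.
  - by rewrite sz.
have [x [y [s [_ unq _ sz]]]] := long #|T|.
by have := max_card (mem (x :: y :: s)); rewrite (card_uniqP unq) /= sz ltnNge leqnSn.
Qed.

End AcyclicGraph.

(** * Partial orders dismantled by removing leaves *)

Section Dismantling.
Variable T : finType.
Implicit Types (r : rel T) (A W : {set T}).

(** Orders are bare relations in this section, so that statements about tops give statements about
    bottoms by passing to [opp r]. *)
Definition opp r : rel T := fun x y => r y x.

Definition porder_rel r := [/\ reflexive r, antisymmetric r & transitive r].

Lemma porder_opp r : porder_rel r -> porder_rel (opp r).
Proof.
case=> rr ra rt; split => [x|x y|y x z]; first exact: rr.
  by rewrite /opp andbC; apply: ra.
by move=> h1 h2; apply: rt h2 h1.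
Qed.

Definition down_chain r A z :=
  {in A &, forall x y, r x z -> r y z -> r x y || r y x}.

(** Every pencil contains one with two elements on each side, so excluding pencils is a condition at
    each possible centre [z]. *)
Definition pencil_free r A :=
  forall z, z \in A -> down_chain r A z \/ down_chain (opp r) A z.

Definition maximal_in r A z := z \in A /\ {in A, forall x, r z x -> x = z}.

Definition good r A z := maximal_in r A z /\ down_chain r A z.

(** In order terms, a leaf of the Hasse diagram that is maximal: isolated, or with [p] as its only
    lower cover. *)
Definition top_leaf r A l := maximal_in r A l /\
  ({in A, forall x, r x l -> x = l} \/
   exists p, [/\ p \in A, p != l, r p l & {in A, forall x, x != l -> r x l -> r x p}]).

Inductive dismantlable r : {set T} -> Prop :=
  | Dismantlable0 : dismantlable r set0
  | DismantlableS A l : top_leaf r A l \/ top_leaf (opp r) A l ->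
      dismantlable r (A :\ l) -> dismantlable r A.

Definition all_good r A :=
  forall W, W \subset A -> W != set0 -> exists v, good r W v \/ good (opp r) W v.

Lemma all_good_opp r A : all_good (opp r) A -> all_good r A.
Proof.
by move=> h W WA Wn0; have [v [g|g]] := h W WA Wn0; exists v; [right|left].
Qed.

(* Let p be the lower cover of the leaf l.  If the elements below p form a
   chain, then l is good.  Otherwise p and l are the only elements above p, so
   that l may be replaced by p when p is not in W. *)
Lemma all_good_step r A l : porder_rel r -> pencil_free r A -> top_leaf r A l ->
  all_good r (A :\ l) -> all_good r A.
Proof.
case=> rr ra rt pf [[lA lmax] leafl] IH W WA Wn0.
have sWA x : x \in W -> x \in A by move/(subsetP WA).
have [lW|lW] := boolP (l \in W); last by apply: IH; rewrite // subsetD1 WA.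
have lmW : maximal_in r W l by split => // x /sWA; apply: lmax.
case: leafl => [iso|[p [pA pl rpl lowp]]].
  exists l; left; split => // x y xW yW rxl ryl.
  by rewrite (iso x (sWA _ xW) rxl) (iso y (sWA _ yW) ryl) rr.
have lchain : down_chain r W p -> down_chain r W l.
  move=> h x y xW yW rxl ryl.
  have [->|xl] := eqVneq x l; first by rewrite ryl orbT.
  have [->|yl] := eqVneq y l; first by rewrite rxl.
  by apply: h => //; apply: lowp => //; apply: sWA.
have [dc|uc] := pf p pA.
  exists l; left; split => //; apply: lchain => x y xW yW.
  by apply: dc; apply: sWA.
have abovep x : x \in A -> r p x -> x = p \/ x = l.
  move=> xA rpx; have [->|xl] := eqVneq x l; first by right.
  left; case/orP: (uc x l xA lA rpx rpl) => h.
    by move: xl; rewrite (lmax x xA h) eqxx.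
  by apply/ra; rewrite rpx andbT lowp.
have [pW|pW] := boolP (p \in W).
  have [v [[[vW vmax] vc]|[[vW vmin] vc]]] : exists v, good r (W :\ l) v \/ good (opp r) (W :\ l) v.
    by apply: IH; [apply: setSD|apply/set0Pn; exists p; rewrite !inE pl].
  - have [vp|vp] := eqVneq v p.
      exists l; left; split => //; apply: lchain => x y xW yW rxp ryp.
      have xl : x != l by apply: contraNneq pl => xl; rewrite -xl in lmax *; rewrite (lmax p).
      have yl : y != l by apply: contraNneq pl => yl; rewrite -yl in lmax *; rewrite (lmax p).
      by apply: vc; rewrite ?vp // !inE ?xl ?yl.
    (* Putting [l] back keeps [v] maximal: if [v] were below [l], it would be below [p] and hence
       equal to it. *)
    move: vW; rewrite !inE => /andP[vl vW].
    exists v; left; split.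
      split => // x xW rvx; have [xl|xl] := eqVneq x l; last by apply: vmax; rewrite // !inE xl.
      have : r v p by apply: lowp; rewrite ?sWA // -xl.
      by move=> /vmax; rewrite !inE pl => /(_ pW) pv; rewrite pv eqxx in vp.
    move=> x y xW yW rxv ryv; apply: vc => //; rewrite !inE ?xW ?yW andbT.
      by apply: contraNneq vl => xl; rewrite -xl in lmax *; rewrite (lmax v) // sWA.
    by apply: contraNneq vl => yl; rewrite -yl in lmax *; rewrite (lmax v) // sWA.
  - move: vW; rewrite !inE => /andP[vl vW].
    exists v; right; split.
      split => // x xW rxv; apply: vmin => //; rewrite !inE xW andbT.
      by apply: contraNneq vl => xl; rewrite -xl in lmax *; rewrite (lmax v) // sWA.
    (* If [l] is above [v], so is [p]; the elements above [v] are then comparable with [p], and by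
       [abovep] they all lie below [l]. *)
    have key y : y \in W -> r v y -> r v l -> r y l.
      move=> yW rvy rvl; have [->//|yl] := eqVneq y l.
      have rvp : r v p by apply: lowp; rewrite ?sWA.
      have yW' : y \in W :\ l by rewrite !inE yl.
      have pW' : p \in W :\ l by rewrite !inE pl.
      case/orP: (vc y p yW' pW' rvy rvp) => h.
        by case: (abovep y (sWA _ yW) h) => ->.
      exact: rt h rpl.
    move=> x y xW yW rxv ryv; rewrite /opp in rxv ryv *.
    have [xl|xl] := eqVneq x l; first by rewrite xl key ?orbT // -xl.
    have [yl|yl] := eqVneq y l; first by rewrite yl orbC key ?orbT // -yl.
    by apply: vc; rewrite ?inE ?xl ?yl.
have [v [[[vW vmax] vc]|[[vW vmin] vc]]] :
    exists v, good r (p |: W :\ l) v \/ good (opp r) (p |: W :\ l) v.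
  apply: IH; last by apply/set0Pn; exists p; rewrite !inE eqxx.
  by rewrite subUset sub1set !inE pl pA setSD.
- have [vp|vp] := eqVneq v p.
    exists l; left; split => //; apply: lchain => x y xW yW rxp ryp.
    have xl : x != l by apply: contraNneq pl => xl; rewrite -xl in lmax *; rewrite (lmax p).
    have yl : y != l by apply: contraNneq pl => yl; rewrite -yl in lmax *; rewrite (lmax p).
    by apply: vc; rewrite ?vp // !inE ?xl ?yl ?xW ?yW orbT.
  move: vW; rewrite !inE (negbTE vp) => /= /andP[vl vW].
  exists v; left; split.
    split => // x xW rvx; have [xl|xl] := eqVneq x l.
      have : r v p by apply: lowp; rewrite ?sWA // -xl.
      by move=> /vmax; rewrite !inE eqxx => /(_ isT) pv; rewrite pv eqxx in vp.
    by apply: vmax; rewrite // !inE xl xW orbT.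
  move=> x y xW yW rxv ryv; apply: vc => //; rewrite !inE ?xW ?yW andbT.
    by apply/orP; right; apply: contraNneq vl => xl; rewrite -xl in lmax *; rewrite (lmax v) // sWA.
  by apply/orP; right; apply: contraNneq vl => yl; rewrite -yl in lmax *; rewrite (lmax v) // sWA.
- have [vp|vp] := eqVneq v p.
    (* As [p] is minimal in the modified set and absent from [W], nothing else in [W] lies below
       [l], which is thus isolated in [W]. *)
    exists l; right; split.
      split => // x xW rxl; have [//|xl] := eqVneq x l.
      have rxp : r x p by apply: lowp; rewrite ?sWA.
      have xp : x = v by apply: vmin; rewrite /opp ?vp // !inE xl xW orbT.
      by move: pW; rewrite -vp -xp xW.
    by move=> x y /sWA xA /sWA yA rlx rly; rewrite (lmax x xA rlx) (lmax y yA rly) /opp rr.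
  move: vW; rewrite !inE (negbTE vp) => /= /andP[vl vW].
  exists v; right; split.
    split => // x xW rxv; apply: vmin => //; rewrite !inE xW andbT; apply/orP; right.
    by apply: contraNneq vl => xl; rewrite -xl in lmax *; rewrite (lmax v) // sWA.
  have key y : y \in W -> r v y -> r v l -> r y l.
    move=> yW rvy rvl; have [->//|yl] := eqVneq y l.
    have rvp : r v p by apply: lowp; rewrite ?sWA.
    have yW' : y \in p |: W :\ l by rewrite !inE yl yW orbT.
    have pW' : p \in p |: W :\ l by rewrite !inE eqxx.
    case/orP: (vc y p yW' pW' rvy rvp) => h.
      by case: (abovep y (sWA _ yW) h) => ->.
    exact: rt h rpl.
  move=> x y xW yW rxv ryv; rewrite /opp in rxv ryv *.
  have [xl|xl] := eqVneq x l; first by rewrite xl key ?orbT // -xl.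
  have [yl|yl] := eqVneq y l; first by rewrite yl orbC key ?orbT // -yl.
  by apply: vc; rewrite ?inE ?xl ?yl ?xW ?yW ?orbT.
Qed.

Lemma dismantlable_all_good r A : porder_rel r -> pencil_free r A ->
  dismantlable r A -> all_good r A.
Proof.
move=> ro pf dA; elim: dA pf => [|{}A l leafl _ IH] pf.
  by move=> W; rewrite subset0 => ->.
have {}IH : all_good r (A :\ l).
  apply: IH => z /setD1P[_ /pf] [h|h]; [left|right];
    by move=> x y /setD1P[_ xA] /setD1P[_ yA]; apply: h.
case: leafl => h; first exact: all_good_step IH.
apply: all_good_opp; apply: all_good_step h _ => //; first exact: porder_opp.
  by move=> z /pf [?|?]; [right|left].
exact: all_good_opp.
Qed.

Definition interval_chains r A := forall a b c d,
  a \in A -> b \in A -> c \in A -> d \in A ->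
  r a b -> r a c -> r b d -> r c d -> r b c || r c b.

Lemma interval_chains_opp r A : interval_chains (opp r) A -> interval_chains r A.
Proof.
move=> h a b c d aA bA cA dA rab rac rbd rcd; rewrite orbC.
exact: (h d b c a).
Qed.

(** If a maximal [l] is one of the middle elements, the claim is immediate; as the upper end [d], it
    can be replaced by its lower cover [p]. *)
Lemma interval_chains_step r A l : porder_rel r -> top_leaf r A l ->
  interval_chains r (A :\ l) -> interval_chains r A.
Proof.
case=> rr ra rt [[lA lmax] leafl] IH a b c d aA bA cA dA rab rac rbd rcd.
have [bl|bl] := eqVneq b l.
  by rewrite bl in rbd *; rewrite -(lmax d dA rbd) rcd orbT.
have [cl|cl] := eqVneq c l.
  by rewrite cl in rcd *; rewrite -(lmax d dA rcd) rbd.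
have al : a != l.
  by apply: contraNneq bl => al; rewrite al in rab; rewrite (lmax b bA rab).
have [dl|dl] := eqVneq d l; last by apply: (IH a b c d); rewrite // !inE ?al ?bl ?cl ?dl.
rewrite dl in rbd rcd; case: leafl => [iso|[p [pA pl rpl lowp]]].
  by move: bl; rewrite (iso b bA rbd) eqxx.
by apply: (IH a b c p); rewrite ?lowp // !inE ?al ?bl ?cl ?pl.
Qed.

Lemma dismantlable_interval_chains r A : porder_rel r ->
  dismantlable r A -> interval_chains r A.
Proof.
move=> ro; elim => [a b c d|{}A l leafl _ IH]; first by rewrite inE.
case: leafl => h; first exact: interval_chains_step IH.
apply: interval_chains_opp; apply: interval_chains_step h _; first exact: porder_opp.
exact: interval_chains_opp.
Qed.

Definition convex_chain r (e : {set T}) :=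
  {in e &, forall x y, r x y || r y x} /\
  {in e &, forall x y, forall z, r x z -> r z y -> z \in e}.

Lemma convex_chain_opp r e : convex_chain r e -> convex_chain (opp r) e.
Proof.
case=> c1 c2; split => [x y xe ye|x y xe ye z h1 h2]; first by rewrite orbC c1.
exact: (c2 y x).
Qed.

(** The traces through [v] consist of elements below [v], which form a chain; by convexity they are
    upper segments of that chain, hence nested, and one of least size is the smallest. *)
Lemma good_nest r (E : {set {set T}}) W v :
  (forall e, e \in E -> convex_chain r e) ->
  good r (W :&: \bigcup_(e in E) e) v ->
  exists e1, [/\ v \in W, e1 \in E, v \in e1
    & forall e, e \in E -> v \in e -> e1 :&: W \subset e :&: W].
Proof.
move=> cv [[]]; rewrite inE => /andP[vW /bigcupP[e0 e0E ve0]] vmax vc.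
pose Q (e : {set T}) := (e \in E) && (v \in e).
have Pe0 : Q e0 by rewrite /Q e0E.
case: (arg_minnP (fun e : {set T} => #|e :&: W|) Pe0) => e1 /andP[e1E ve1] min1.
exists e1; split => // e eE ve; apply/subsetP => x xe1; apply/idPn => xe.
have hn : ~~ (e :&: W \subset e1 :&: W).
  apply/negP => sub; have := min1 e; rewrite /Q eE ve => /(_ isT).
  rewrite leqNgt (proper_card) // properE sub; apply/subsetPn; by exists x.
have [y ye ye1] := subsetPn hn.
move: xe1 ye xe ye1; rewrite !inE => /andP[xe1 xW] /andP[ye yW].
rewrite xW yW !andbT => xe ye1.
have below z f : f \in E -> v \in f -> z \in f -> z \in W ->
    z \in W :&: \bigcup_(e in E) e /\ r z v.
  move=> fE vf zf zW; have zV : z \in W :&: \bigcup_(e in E) e.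
    by rewrite inE zW; apply/bigcupP; exists f.
  split => //; case/orP: ((cv f fE).1 z v zf vf) => // h.
  by move: (h); rewrite (vmax z zV h).
have [xV rxv] := below x e1 e1E ve1 xe1 xW.
have [yV ryv] := below y e eE ve ye yW.
case/orP: (vc x y xV yV rxv ryv) => h.
  by case/negP: ye1; apply: (cv e1 e1E).2 h ryv.
by case/negP: xe; apply: (cv e eE).2 h rxv.
Qed.

Lemma convex_chains_nest r (E : {set {set T}}) W : porder_rel r ->
  dismantlable r setT -> pencil_free r setT ->
  (forall e, e \in E -> convex_chain r e) ->
  E != set0 -> (forall e, e \in E -> e :&: W != set0) ->
  exists v e1, [/\ v \in W, e1 \in E, v \in e1
    & forall e, e \in E -> v \in e -> e1 :&: W \subset e :&: W].
Proof.
move=> ro dis pf cv En0 eW.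
have [|v] := dismantlable_all_good ro pf dis (subsetT (W :&: \bigcup_(e in E) e)).
  have [e eE] := set0Pn _ En0; have [x] := set0Pn _ (eW e eE).
  rewrite inE => /andP[xe xW]; apply/set0Pn; exists x; rewrite inE xW.
  by apply/bigcupP; exists e.
case=> /good_nest h; exists v; apply: h => // e /cv //.
exact: convex_chain_opp.
Qed.

(** The analogue of [covers] for a bare relation, in a form suited to duality. *)
Definition cov r A x y := [&& x \in A, y \in A, x != y, r x y
  & [forall z in A, ~~ [&& x != z, r x z, z != y & r z y]]].

Lemma cov_opp r A x y : cov (opp r) A x y = cov r A y x.
Proof.
rewrite /cov /opp eq_sym; case: (x \in A); rewrite ?andbF //=.
congr [&& _, _, _ & _]; apply: eq_forallb_in => z _.
rewrite (eq_sym x z) (eq_sym z y).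
by case: (z != x); case: (y != z); case: (r z x); case: (r y z).
Qed.

Lemma cov_below r A x y : porder_rel r -> x \in A -> y \in A -> x != y -> r x y ->
  exists2 p, cov r A p y & r x p.
Proof.
move=> [rr ra rt].
have [m] := ubnP #|[set z in A | (r x z) && (r z y)]|.
elim: m x => // m IH x; rewrite ltnS => le xA yA xy rxy.
have [h|/forall_inPn[z zA]] := boolP [forall z in A, ~~ [&& x != z, r x z, z != y & r z y]].
  by exists x; rewrite // /cov xA yA xy rxy.
rewrite negbK => /and4P[xz rxz zy rzy].
have [] // := IH z.
  apply: leq_trans le; apply: proper_card; rewrite properE; apply/andP; split.
    by apply/subsetP => w; rewrite !inE => /and3P[-> /(rt _ _ _ rxz)-> ->].
  apply/subsetPn; exists x; rewrite !inE ?rr ?rxy ?xA //=.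
  by rewrite negb_and; apply/orP; left; apply: contra xz => rzx; apply/eqP/ra; rewrite rxz.
by move=> p cp rzp; exists p => //; apply: rt rzp.
Qed.

Lemma cov_above r A x y : porder_rel r -> x \in A -> y \in A -> x != y -> r y x ->
  exists2 p, cov r A y p & r p x.
Proof.
move=> ro xA yA xy ryx.
have [] // := @cov_below (opp r) A x y (porder_opp ro) xA yA xy ryx.
by move=> p; rewrite cov_opp => c h; exists p.
Qed.

(** If something lies below [l], the only Hasse neighbour [p] is a lower cover: everything below [l]
    passes through [p], and an element above [l] would yield a second neighbour. Otherwise the dual
    argument applies or [l] is isolated. *)
Lemma unique_cov_top_leaf r A l : porder_rel r -> l \in A ->
  {in A &, forall y z, cov r A l y || cov r A y l -> cov r A l z || cov r A z l -> y = z} ->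
  top_leaf r A l \/ top_leaf (opp r) A l.
Proof.
move=> ro lA unq.
have half r' : porder_rel r' ->
    {in A &, forall y z, cov r' A l y || cov r' A y l -> cov r' A l z || cov r' A z l -> y = z} ->
    (exists2 x, x \in A & (x != l) && r' x l) -> top_leaf r' A l.
  move=> ro' unq' [x xA /andP[xl rxl]].
  have [p cp rxp] := cov_below ro' xA lA xl rxl.
  case/and5P: (cp) => pA _ pl rpl _; split.
    split => // y yA rly; apply/eqP; apply: contraTT rpl => yl.
    have [q cq rqy] := cov_above ro' yA lA yl rly.
    case/and5P: (cq) => _ qA lq rlq _.
    have pq : p = q by apply: unq'; rewrite ?cp ?cq ?orbT.
    apply: contra pl => rpl; apply/eqP; have [_ ra _] := ro'.
    by apply: ra; rewrite rpl pq.
  right; exists p; split => // y yA yl ryl.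
  have [q cq rqy] := cov_below ro' yA lA yl ryl.
  by rewrite (unq' p q) ?cp ?cq ?orbT //; case/and5P: cq.
have [/exists_inP|/exists_inPn no] := boolP [exists x in A, (x != l) && r x l].
  by left; apply: half.
have [/exists_inP|/exists_inPn no'] := boolP [exists x in A, (x != l) && r l x].
  right; apply: half => //; first exact: porder_opp.
  by move=> y z yA zA; rewrite !(cov_opp r) orbC => h1; rewrite orbC; apply: unq.
left; split; first split => //.
  by move=> x xA rlx; apply/eqP; have := no' x xA; rewrite rlx andbT negbK.
by left => x xA rlx; apply/eqP; have := no x xA; rewrite rlx andbT negbK.
Qed.

(** A new covering pair would have [l] between its ends, giving [l] both a lower and an upper
    cover. *)
Lemma unique_cov_rem r A l x y : porder_rel r -> l \in A ->
  {in A &, forall y z, cov r A l y || cov r A y l -> cov r A l z || cov r A z l -> y = z} ->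
  cov r (A :\ l) x y -> cov r A x y.
Proof.
move=> ro lA unq /and5P[/setD1P[xl xA] /setD1P[yl yA] xy rxy /forall_inP h].
apply/and5P; split => //; apply/forall_inP => z zA.
have [->|zl] := eqVneq z l; last by apply: h; rewrite !inE zl.
apply/negP => /and4P[_ rxl ly rly].
have [p cp rxp] := cov_below ro xA lA xl rxl.
have [q cq rqy] := cov_above ro yA lA yl rly.
have pq : p = q.
  by apply: unq; rewrite ?cp ?cq ?orbT //; [case/and5P: cp|case/and5P: cq].
case/and5P: cp => _ _ pl rpl _; case/and5P: cq => _ _ _ rlq _.
have [_ ra _] := ro; case/eqP: pl; apply: ra.
by rewrite rpl pq.
Qed.

End Dismantling.

(** * Forest posets are dismantlable, and their paths are convex chains *)

Section Forest.
Variables (disp : Order.disp_t) (P : finPOrderType disp).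
Implicit Types (x y z : P) (A : {set P}).

Let le : rel P := fun x y => (x <= y)%O.

Lemma porder_le : porder_rel le.
Proof.
split; [exact: lexx|exact: le_anti|exact: le_trans].
Qed.

Lemma cov_le A x y : cov le A x y = covers A x y.
Proof.
rewrite /cov /covers /le lt_neqAle -!andbA.
do 4 congr (_ && _); apply: eq_forallb_in => z _.
by rewrite !lt_neqAle !andbA.
Qed.

Lemma coversS (A B : {set P}) x y : A \subset B -> x \in A -> y \in A ->
  covers B x y -> covers A x y.
Proof.
move=> AB xA yA /and4P[_ _ xy /forall_inP h]; rewrite /covers xA yA xy.
by apply/forall_inP => z /(subsetP AB); apply: h.
Qed.

Lemma hasse_irr A : irreflexive (hasse A).
Proof. by move=> x; rewrite /hasse /covers ltxx !andbF. Qed.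

Lemma hasse_sym A : ssrbool.symmetric (hasse A).
Proof. by move=> x y; rewrite /hasse orbC. Qed.

Hypothesis forestP : forest_poset P.

Lemma forest_block x : exists A,
  [/\ x \in A, tree_poset A & {in A, forall z y, (z >=< y)%O -> y \in A}].
Proof.
have [Q [partQ treeQ disjQ]] := forestP.
have /bigcupP[A AQ xA] : x \in cover Q by rewrite (cover_partition partQ) inE.
exists A; split => // [|z zA y czy]; first exact: treeQ.
have /bigcupP[B BQ yB] : y \in cover Q by rewrite (cover_partition partQ) inE.
have [->//|AB] := eqVneq A B.
by have := disjQ A B AQ BQ AB z y zA yB; rewrite czy.
Qed.

Lemma forest_pencil_free : pencil_free le [set: P].
Proof.
move=> z _; have [A [zA [_ noP] inA]] := forest_block z.
have [h|/forallPn[x1 /forallPn[x2]]] :=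
    boolP [forall x, forall y, le x z ==> le y z ==> (le x y || le y x)].
  left=> x y _ _ xz yz; move/forallP: h => /(_ x) /forallP /(_ y).
  by rewrite xz yz.
rewrite !negb_imply negb_or => /and4P[x1z x2z x12 x21].
have [h|/forallPn[y1 /forallPn[y2]]] :=
    boolP [forall x, forall y, le z x ==> le z y ==> (le x y || le y x)].
  right=> x y _ _ zx zy; move/forallP: h => /(_ x) /forallP /(_ y).
  by move/implyP/(_ zx)/implyP/(_ zy); rewrite orbC.
rewrite !negb_imply negb_or => /and4P[zy1 zy2 y12 y21].
have neq a b : ~~ le a b -> a != b by apply: contraNneq => ->; apply: lexx.
have anti a b : ~~ le a b -> ~~ le b a -> antichain [set a; b].
  move=> nab nba c d; rewrite !inE => /orP[/eqP->|/eqP->] /orP[/eqP->|/eqP->] //.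
    by move=> h; case/negP: nab.
  by move=> h; case/negP: nba.
have cz w : le z w || le w z -> w \in A by apply: (inA z zA).
case: (noP ([set x1; x2] :|: [set z] :|: [set y1; y2])).
  apply/subsetP => w; rewrite !inE => /orP[/orP[/orP[]|]|/orP[]] /eqP->; apply: cz;
  by rewrite ?zy1 ?zy2 ?x1z ?x2z ?lexx ?orbT // /le lexx.
exists [set x1; x2], z, [set y1; y2]; split => //; first by rewrite !cards2 !neq.
- split=> w; rewrite !inE => /orP[] /eqP->; rewrite lt_neqAle.
  + by rewrite [X in _ && X]x1z andbT; apply: contraNneq x21 => ->.
  + by rewrite [X in _ && X]x2z andbT; apply: contraNneq x12 => ->.
  + by rewrite [X in _ && X]zy1 andbT; apply: contraNneq y12 => <-.
  + by rewrite [X in _ && X]zy2 andbT; apply: contraNneq y21 => <-.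
- exact: anti.
- exact: anti.
Qed.

Lemma forest_dismantlable : dismantlable le [set: P].
Proof.
(* Generalised to sets [A] whose coverings are coverings of the whole poset, so that the Hasse
   diagram of [A] stays inside the forest; removing a leaf keeps this property. *)
have: forall x y, cov le [set: P] x y -> cov le [set: P] x y by [].
move: {1 3}[set: P] => A; have [m] := ubnP #|A|; elim: m A => // m IH A.
rewrite ltnS => leA cA.
have [->|/set0Pn[x xA]] := eqVneq A set0; first exact: Dismantlable0.
have [K [xK [[_ _ acyc] _] inK]] := forest_block x.
have [|l] := acyclic_has_leaf (@hasse_irr K) (@hasse_sym K) acyc (subsetIr A K).
  by apply/set0Pn; exists x; rewrite inE xA.
rewrite inE => /andP[lA lK] unq.
have nbr y : y \in A -> cov le A l y || cov le A y l -> (y \in A :&: K) && hasse K l y.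
  move=> yA h.
  have {}h : covers setT l y || covers setT y l.
    by rewrite -!cov_le; case/orP: h => /cA ->; rewrite ?orbT.
  have yK : y \in K.
    apply: (inK l lK); case/orP: h => /and4P[_ _ /ltW h _];
    by rewrite /Order.comparable h ?orbT.
  rewrite inE yA yK /hasse /=.
  by case/orP: h => /(coversS (subsetT K)) ->; rewrite ?orbT.
have {}unq : {in A &, forall y z, cov le A l y || cov le A y l ->
    cov le A l z || cov le A z l -> y = z}.
  move=> y z yA zA /(nbr y yA)/andP[yB hy] /(nbr z zA)/andP[zB hz].
  exact: unq.
apply: (@DismantlableS _ _ _ l); first exact: unique_cov_top_leaf porder_le lA unq.
apply: IH; first by rewrite (cardsD1 l) lA in leA.
by move=> y z /(unique_cov_rem porder_le lA unq)/cA.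
Qed.

(** An element between two elements of a path is comparable with the whole path, because intervals
    are chains. Climbing the path, one must meet it, because consecutive elements are coverings. *)
Lemma path_convex_chain (p : seq P) :
  sorted (covers [set: P]) p -> convex_chain le [set x in p].
Proof.
move=> sp; have slt : sorted <%O p by apply: sub_sorted sp => x y /and4P[].
have chain : {in p &, forall x y, le x y || le y x}.
  move=> x y xp yp; rewrite /le.
  have [i ip <-] := nthP x xp; have [j jp <-] := nthP x yp.
  have sle : sorted <=%O p by apply: sub_sorted slt => ? ? /ltW.
  case: (leqP i j) => [ij|/ltnW ij].
    by rewrite (sorted_leq_nth le_trans lexx) ?inE.
  by rewrite orbC (sorted_leq_nth le_trans lexx) ?inE.
have ic := dismantlable_interval_chains porder_le forest_dismantlable.
split=> [x y|x y]; rewrite !inE; first exact: chain.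
move=> xp yp z xz zy; rewrite inE.
have {chain ic} cmp w : w \in p -> le w z || le z w.
  move=> wp; case/orP: (chain x w xp wp) => xw; last by rewrite /le (le_trans xw xz).
  case/orP: (chain w y wp yp) => wy; last by rewrite orbC /le (le_trans zy wy).
  by apply: (ic x w z y); rewrite ?inE.
elim: p x xp yp sp slt cmp xz => [//|a p IH] x xp yp sp slt cmp xz.
have [->|za] := eqVneq z a; first exact: mem_head.
rewrite inE (negbTE za) /=.
have az : (a < z)%O.
  rewrite lt_neqAle eq_sym za /=; move: xp; rewrite inE => /orP[/eqP<- //|xp].
  apply: le_trans xz; apply: ltW.
  move: slt; rewrite /= path_sortedE; last exact: lt_trans.
  by case/andP => /allP/(_ _ xp).
move: yp; rewrite inE => /orP[/eqP ya|yp].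
  by have := le_lt_trans zy (_ : (y < z)%O); rewrite ya ltxx => /(_ az).
case: p IH xp yp sp slt cmp => // b p IH _ yp sp slt cmp.
case/andP: sp => /and4P[_ _ ab /forall_inP hab] sp.
have bz : le b z.
  have bp : b \in a :: b :: p by rewrite !inE eqxx orbT.
  case/orP: (cmp b bp) => //.
  rewrite /le le_eqVlt => /orP[/eqP->|zb]; first exact: lexx.
  by have := hab z (in_setT z); rewrite az zb.
apply: (IH b) => //; first exact: mem_head.
  by case/andP: slt.
by move=> w wp; apply: cmp; rewrite inE wp orbT.
Qed.

Lemma path_sets_nest (t : nat) (E : {set {set P}}) (W : {set P}) :
  E \subset [set [set x in tval p] | p : t.-tuple P & sorted (covers [set: P]) p] ->
  E != set0 -> (forall e, e \in E -> e :&: W != set0) ->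
  exists v e1, [/\ v \in W, e1 \in E, v \in e1
    & forall e, e \in E -> v \in e -> e1 :&: W \subset e :&: W].
Proof.
move=> sE; apply: (convex_chains_nest porder_le forest_dismantlable forest_pencil_free).
move=> e /(subsetP sE)/imsetP[p]; rewrite inE => sp ->.
exact: path_convex_chain.
Qed.

End Forest.

Local Open Scope ring_scope.

(** * Regular sequences on subquotients *)

Section Regular.
Variable R : comNzRingType.
Implicit Types (A B C J : R -> Prop) (f u : R) (fs : seq R).

Lemma ideal0 J : is_ideal J -> J 0. Proof. by case. Qed.

Lemma idealD J f g : is_ideal J -> J f -> J g -> J (f + g).
Proof. by case=> _ h _; apply: h. Qed.

Lemma idealM J f g : is_ideal J -> J f -> J (g * f).
Proof. by case=> _ _ h; apply: h. Qed.

Lemma idealB J f g : is_ideal J -> J f -> J g -> J (f - g).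
Proof. by move=> iJ Jf Jg; apply: idealD => //; rewrite -mulN1r; apply: idealM. Qed.

Lemma idealDr J f g : is_ideal J -> J f -> J (f + g) -> J g.
Proof. by move=> iJ Jf Jfg; rewrite -[g](addKr f) addrC; apply: idealB. Qed.

Lemma ideal_sum J (I : Type) (r : seq I) (P : pred I) (F : I -> R) :
  is_ideal J -> (forall i, P i -> J (F i)) -> J (\sum_(i <- r | P i) F i).
Proof.
move=> iJ JF; apply: (big_ind J) => //; first exact: ideal0.
by move=> f g; apply: idealD.
Qed.

Lemma ideal_gen_ideal (G : R -> Prop) : is_ideal (ideal_gen G).
Proof.
split.
- by exists 0%N, (fun _ => 0), (fun _ => 0); split; [case|rewrite big_ord0].
- move=> _ _ [m1 [a1 [g1 [G1 ->]]]] [m2 [a2 [g2 [G2 ->]]]].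
  pose h T (x1 : 'I_m1 -> T) x2 (i : 'I_(m1 + m2)) :=
    match split i with inl j => x1 j | inr j => x2 j end.
  exists (m1 + m2)%N, (h _ a1 a2), (h _ g1 g2); split.
    by move=> i; rewrite /h; case: split.
  rewrite big_split_ord /=; congr (_ + _); apply: eq_bigr => i _; rewrite /h.
    by rewrite (unsplitK (inl i)).
  by rewrite (unsplitK (inr i)).
- move=> b _ [m [a [g [Gg ->]]]]; exists m, (fun i => b * a i), g; split => //.
  by rewrite mulr_sumr; apply: eq_bigr => i _; rewrite mulrA.
Qed.

Lemma ideal_gen_mem (G : R -> Prop) g : G g -> ideal_gen G g.
Proof.
move=> Gg; exists 1%N, (fun=> 1), (fun=> g); split=> //.
by rewrite big_ord1 mul1r.
Qed.

Lemma add_mul_ideal A B f : is_ideal A -> is_ideal B -> is_ideal (add_mul A B f).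
Proof.
move=> iA iB; split.
- by exists 0; [exact: ideal0|exists 0; rewrite ?mulr0 ?addr0 //; exact: ideal0].
- move=> _ _ [b1 B1 [a1 A1 ->]] [b2 B2 [a2 A2 ->]].
  exists (b1 + b2); first exact: idealD.
  by exists (a1 + a2); [exact: idealD|ring].
- move=> g _ [b Bb [a Aa ->]]; exists (g * b); first exact: idealM.
  by exists (g * a); [exact: idealM|ring].
Qed.

Lemma sub_add_mul A B f : is_ideal A -> sub_ideal B (add_mul A B f).
Proof.
move=> iA b Bb; exists b => //; exists 0; first exact: ideal0.
by rewrite mulr0 addr0.
Qed.

(* [regular_seq] with the final condition M / (fs) M != 0 made optional. *)
Fixpoint regular_upto (proper : bool) A B fs : Prop :=
  if fs is f :: fs' then
    (forall a, A a -> B (f * a) -> B a) /\ regular_upto proper A (add_mul A B f) fs'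
  else if proper then ~ sub_ideal A B else True.

Lemma regular_uptoT A B fs : regular_upto true A B fs -> regular_seq A B fs.
Proof. by elim: fs A B => //= f fs IH A B [h1 /IH]. Qed.

Lemma regular_uptoW p A B fs : regular_upto p A B fs -> regular_upto false A B fs.
Proof. by elim: fs A B => //= f fs IH A B [h1 /IH]. Qed.

(* The hypotheses say that a |-> u * a induces an isomorphism from A1 / B1 onto
   A2 / B2. *)
Lemma regular_upto_iso p u A1 B1 A2 B2 fs :
  is_ideal A1 -> is_ideal A2 -> is_ideal B2 ->
  (forall a, A1 a -> A2 (u * a)) ->
  (forall a, A2 a -> exists2 b, B2 b & exists2 a', A1 a' & a = b + u * a') ->
  (forall a, A1 a -> (B2 (u * a) <-> B1 a)) ->
  regular_upto p A1 B1 fs -> regular_upto p A2 B2 fs.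
Proof.
move=> iA1 iA2; elim: fs B1 B2 => [|f fs IH] B1 B2 iB2 uA A2dec equ /=.
  case: p => // h sub; apply: h => a Aa; apply/equ => //.
  exact/sub/uA.
case=> reg1 /IH regs; split.
  move=> a /A2dec[b Bb [a' Aa' ->]] fB; apply: idealD => //; apply/equ => //.
  apply: reg1 => //; apply/equ; first exact: idealM.
  apply: (@idealDr _ (f * b)) => //; first exact: idealM.
  by rewrite [u * _]mulrCA -mulrDr.
apply: regs => //; first exact: add_mul_ideal.
  by move=> a /A2dec[b Bb h]; exists b => //; apply: sub_add_mul.
move=> a Aa; split.
  move=> [b Bb [_ /A2dec[b' Bb' [a' Aa' ->]] e]].
  exists (a - f * a'); last by exists a' => //; ring.
  apply/equ; first by apply: idealB => //; apply: idealM.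
  have -> : u * (a - f * a') = b + f * b'.
    by rewrite mulrBr e; ring.
  by apply: idealD => //; apply: idealM.
move=> [b Bb [a' Aa' e]].
have Ab : A1 b.
  have -> : b = a - f * a' by rewrite e; ring.
  by apply: idealB => //; apply: idealM.
exists (u * b); first exact/equ.
by exists (u * a'); [exact: uA|rewrite e; ring].
Qed.

(** Regular sequences glue along the extension of [A / C] by [C / B], which stays exact after
    reduction modulo a regular element. *)
Lemma regular_upto_ext p A B C fs : is_ideal A -> is_ideal B -> is_ideal C ->
  sub_ideal B C -> sub_ideal C A ->
  regular_upto false C B fs -> regular_upto p A C fs -> regular_upto p A B fs.
Proof.
move=> iA; elim: fs B C => [|f fs IH] B C iB iC BC CA /=.
  by case: p => // _ h AB; apply: h => a /AB/BC.
move=> [regB regsB] [regC regsC]; split.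
  move=> a Aa Bfa; apply: regB => //.
  by apply: regC => //; apply: BC.
have iBA : is_ideal (add_mul A B f) by exact: add_mul_ideal.
have iCA : is_ideal (add_mul A C f) by exact: add_mul_ideal.
apply: (IH _ (add_mul A C f)) => //.
- by move=> _ [b Bb [a Aa ->]]; exists b; [exact: BC|exists a].
- move=> _ [c Cc [a Aa ->]]; apply: idealD => //; first exact: CA.
  exact: idealM.
(* As [f] is regular on [A / C], the ideals [C] and [B + f A] meet in [B + f C]; hence
   [C / (B + f C)] is isomorphic to [(C + f A) / (B + f A)]. *)
apply: (@regular_upto_iso _ 1 C (add_mul C B f)) => //.
- by move=> c Cc; rewrite mul1r; apply: sub_add_mul.
- move=> _ [c Cc [a Aa ->]]; exists (f * a).
    by exists 0; [exact: ideal0|exists a; rewrite ?add0r].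
  by exists c; rewrite // mul1r addrC.
- move=> c Cc; rewrite mul1r; split=> -[b Bb [a Aa e]]; exists b => //; exists a => //.
    apply: regC => //; apply: (@idealDr _ b) => //; first exact: BC.
    by rewrite -e.
  exact: CA.
Qed.

End Regular.

(** * Squarefree monomial ideals *)

Section MonomialIdeals.
Variables (k : fieldType) (n : nat).
Local Notation S := {mpoly k[n]}.
Implicit Types (f g : S) (m : 'X_{1..n}) (D : pred {set 'I_n}) (F G s t : {set 'I_n}).

Definition mnm_set m : {set 'I_n} := [set i | m i != 0%N].

Lemma mnm_setD m1 m2 : mnm_set (m1 + m2) = mnm_set m1 :|: mnm_set m2.
Proof. by apply/setP => i; rewrite !inE mnmDE addn_eq0 negb_and. Qed.

Lemma mnm_set_mesym1 G : mnm_set (mesym1 G) = G.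
Proof. by apply/setP => i; rewrite !inE mnmE; case: (i \in G). Qed.

Lemma mesym1_dvd G m : G \subset mnm_set m -> m = ((m - mesym1 G) + mesym1 G)%MM.
Proof.
move=> Gm; apply/mnmP => i; rewrite mnmDE mnmBE mnmE subnK //.
case: (boolP (i \in G)) => // /(subsetP Gm); rewrite inE.
by case: (m i).
Qed.

Definition down_closed D := forall s t, s \subset t -> D t -> D s.

(** The Stanley-Reisner ideal of [D], described by supports instead of generators. *)
Definition monideal D : S -> Prop :=
  fun f => {in msupp f, forall m, ~~ D (mnm_set m)}.

Lemma monideal_ideal D : down_closed D -> is_ideal (monideal D).
Proof.
move=> dD; split=> [m|f g If Ig m|f g Ig m].
- by rewrite msupp0.
- by move/msuppD_le; rewrite mem_cat => /orP[/If|/Ig].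
- move/msuppM_le/allpairsP => -[[m1 m2] /= [_ m2g ->]].
  by apply: contra (Ig _ m2g); apply: dD; rewrite mnm_setD subsetUr.
Qed.

Lemma monidealX D m : monideal D 'X_[m] <-> ~~ D (mnm_set m).
Proof.
split=> [h|h m']; first by apply: h; rewrite msuppX mem_head.
by rewrite msuppX inE => /eqP->.
Qed.

Lemma monideal_ind D (J : S -> Prop) : is_ideal J ->
  (forall m, ~~ D (mnm_set m) -> J 'X_[m]) -> sub_ideal (monideal D) J.
Proof.
move=> iJ JX f If; rewrite [f]mpolyE big_seq; apply: ideal_sum => // m mf.
by rewrite -mul_mpolyC; apply: idealM => //; apply/JX/If.
Qed.

Lemma monidealS D D' : {subset D <= D'} -> sub_ideal (monideal D') (monideal D).
Proof. by move=> sD f If m /If; apply: contra; apply: sD. Qed.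

Lemma monideal_homogeneous D : down_closed D -> homogeneous_ideal (monideal D).
Proof.
move=> dD; split; first exact: monideal_ideal.
move=> f If d m; rewrite mcoeff_msupp => nz; apply: If; rewrite mcoeff_msupp.
apply: contraNneq nz => fm0; rewrite raddf_sum big1 //= => m' _.
rewrite mcoeffZ mcoeffX; case: eqVneq => [->|]; last by rewrite mulr0.
by rewrite fm0 mul0r.
Qed.

Definition face F : pred {set 'I_n} := fun s => s \subset F.

Lemma face_down F : down_closed (face F).
Proof. by move=> s t st; apply: subset_trans. Qed.

(** Sets the variables outside [F] to 0; the kernel is [monideal (face F)], which is therefore
    prime. *)
Definition restrict F : S -> S := comp_mpoly [tuple (if i \in F then 'X_i else 0) | i < n].

Lemma restrictX F m : restrict F 'X_[m] = if mnm_set m \subset F then 'X_[m] else 0.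
Proof.
rewrite /restrict comp_mpolyX.
case: ifPn => [/subsetP mF|/subsetPn[i mi iF]].
  rewrite mpolyXE_id; apply: eq_bigr => i _; rewrite tnth_mktuple.
  case: ifPn => // iF; have := contra (mF i) iF; rewrite inE negbK => /eqP->.
  by rewrite !expr0.
rewrite (bigD1 i) //= tnth_mktuple (negbTE iF) expr0n.
by rewrite inE in mi; rewrite (negbTE mi) mul0r.
Qed.

Lemma mcoeff_restrict F f m :
  (restrict F f)@_m = if mnm_set m \subset F then f@_m else 0.
Proof.
rewrite /restrict comp_mpolyEX raddf_sum /= -/(restrict F).
transitivity (\sum_(m' <- msupp f) (if mnm_set m \subset F then (f@_m' *: 'X_[m'])@_m else 0)).
  apply: eq_bigr => m' _; rewrite -/(restrict F _) restrictX !mcoeffZ !mcoeffX.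
  have [->|ne] := eqVneq m' m.
    by case: ifP => _; rewrite ?mcoeffX ?eqxx ?mcoeff0 ?mulr0.
  rewrite mulr0 if_same; case: ifP => _; rewrite ?mcoeff0 ?mulr0 //.
  by rewrite mcoeffX (negbTE ne) mulr0.
case: ifP => _; last by rewrite big1.
by rewrite -raddf_sum -mpolyE.
Qed.

Lemma restrict_eq0 F f : monideal (face F) f <-> restrict F f = 0.
Proof.
split=> [If|/mpolyP f0 m].
  apply/mpolyP => m; rewrite mcoeff_restrict mcoeff0.
  case: ifP => // mF; apply: memN_msupp_eq0; apply/negP => /If.
  by rewrite /face mF.
rewrite mcoeff_msupp /face; apply: contra => mF.
by have := f0 m; rewrite mcoeff_restrict mF mcoeff0 => ->.
Qed.

Lemma face_prime F : prime_ideal (monideal (face F)).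
Proof.
split; first exact: monideal_ideal (face_down (F := F)).
  move/(_ 0%MM); rewrite msupp1 mem_head => /(_ isT)/negP; apply.
  by apply/subsetP => i; rewrite inE mnmE.
move=> f g /restrict_eq0; rewrite /restrict rmorphM => /eqP.
by rewrite mulf_eq0 => /orP[] /eqP/restrict_eq0; [left|right].
Qed.

(* Decreasing degrees: killing e_(d+1) in k[F] with |F| = d + 1 leaves a quotient
   filtered by copies of k[F'] with |F'| = d. *)
Fixpoint esyms d : seq S :=
  if d is d'.+1 then mesym n k d :: esyms d' else [::].

Lemma size_esyms d : size (esyms d) = d.
Proof. by elim: d => //= d ->. Qed.

Lemma esyms_irrelevant d : {in esyms d, forall f, irrelevant_ideal f}.
Proof.
elim: d => //= d IH f; rewrite inE => /orP[/eqP->|]; last exact: IH.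
have iI : is_ideal (@irrelevant_ideal k n) by exact: ideal_gen_ideal.
apply: ideal_sum => // h /eqP hd.
have /card_gt0P[i ih] : (0 < #|h|)%N by rewrite hd.
rewrite (bigD1 i) //= mulrC; apply: idealM => //.
by apply: ideal_gen_mem; exists i.
Qed.

(** The unit ideal, in the form it takes in [shelling_regular] when [D'] is empty. *)
Definition whole := monideal pred0.

Lemma regular_upto_trivial (A B : S -> Prop) fs : is_ideal A ->
  sub_ideal A B -> regular_upto false A B fs.
Proof.
move=> iA; elim: fs B => //= f fs IH B AB; split=> [a /AB//|].
by apply: IH => a /AB; apply: sub_add_mul.
Qed.

Definition faces_regular d := forall F, #|F| = d ->
  regular_upto true whole (monideal (face F)) (esyms d).

(** Adding the intervals to [D'] one at a time filters the quotient. The layer of [[G, F]] is a copy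
    of [k[F]] shifted by the monomial of [G], and regular sequences glue along extensions. *)
Lemma shelling_regular d D' D (L : seq ({set 'I_n} * {set 'I_n})) :
  faces_regular d -> down_closed D' -> down_closed D ->
  {in L, forall a : {set 'I_n} * {set 'I_n}, [/\ a.1 \subset a.2, #|a.2| = d & ~~ D' a.1]} ->
  pairwise (fun a b : {set 'I_n} * {set 'I_n} => ~~ (b.1 \subset a.2)) L ->
  (forall s, D s = D' s || has (in_interval s) L) ->
  regular_upto (L != [::]) (monideal D') (monideal D) (esyms d).
Proof.
move=> reg; elim: L D' => [|[G F] L IH] D' dD' dD inL pw DE.
  apply: regular_upto_trivial; first exact: monideal_ideal.
  by apply: monidealS => s; rewrite !unfold_in DE orbF.
have /= [GF cF nG] := inL (G, F) (mem_head _ _).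
case/andP: pw => /allP /= notG pw.
pose D1 s := D' s || in_interval s (G, F).
(* A subset of a face in [[G, F]] belongs to [D], but to no later interval, since the bottom of such
   an interval is not contained in [F]. *)
have dD1 : down_closed D1.
  move=> s t st; rewrite /D1 => /orP[/(dD' _ _ st)->//|/andP[/= Gt tF]].
  have : D t by rewrite DE /= /in_interval /= Gt tF orbT.
  move/(dD _ _ st); rewrite DE /= orbA => /orP[//|/hasP[a aL /andP[as1 _]]].
  by case/negP: (notG a aL); apply: subset_trans as1 (subset_trans st tF).
have iD1 := monideal_ideal dD1.
apply: (@regular_upto_ext _ _ _ _ (monideal D1)) => //.
- exact: monideal_ideal.
- exact: monideal_ideal.
- by apply: monidealS => s; rewrite !unfold_in /D1 DE /= orbA => ->.
- by apply: monidealS => s; rewrite !unfold_in /D1 => ->.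
- apply: (@regular_uptoW _ (L != [::])); apply: IH => //.
  + move=> a aL; have [|a1 a2 a3] := inL a; first by rewrite inE aL orbT.
    split=> //; rewrite /D1 negb_or a3 /= negb_and; apply/orP; right; exact: notG.
  + by move=> s; rewrite DE /= orbA.
apply: (@regular_upto_iso _ true 'X_[mesym1 G] whole (monideal (face F))); last exact: reg.
- exact: monideal_ideal.
- exact: monideal_ideal.
- exact: iD1.
- move=> a _; rewrite mulrC; apply: (idealM _ (monideal_ideal dD')).
  by apply/monidealX; rewrite mnm_set_mesym1.
- move=> f If; rewrite [f]mpolyE big_seq.
  apply: (big_ind (fun a => exists2 b, monideal D1 b & exists2 a', whole a' &
      a = b + 'X_[mesym1 G] * a')).
  + by exists 0; [exact: ideal0 iD1|exists 0; rewrite // mulr0 addr0].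
  + move=> _ _ [b1 B1 [a1 _ ->]] [b2 B2 [a2 _ ->]].
    by exists (b1 + b2); [exact: (idealD iD1)|exists (a1 + a2) => //; ring].
  + move=> m /If D'm; have [/andP[/= Gm _]|nin] := boolP (in_interval (mnm_set m) (G, F)).
      exists 0; first exact: ideal0 iD1.
      exists (f@_m *: 'X_[m - mesym1 G]) => //.
      by rewrite add0r -scalerAr mulrC -mpolyXD -(mesym1_dvd Gm).
    exists (f@_m *: 'X_[m]); last by exists 0; rewrite // mulr0 addr0.
    rewrite -mul_mpolyC; apply: (idealM _ iD1); apply/monidealX.
    by rewrite /D1 negb_or D'm.
- move=> a _; split=> [h m ma|Fa].
    have := h (mesym1 G + m)%MM; rewrite mulrC (perm_mem (msuppMX _ _)) map_f //.
    move/(_ isT); rewrite mnm_setD mnm_set_mesym1 /D1 negb_or => /andP[_].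
    by rewrite /in_interval /= subsetUl subUset GF.
  move=> m; rewrite mulrC (perm_mem (msuppMX _ _)) => /mapP[m' /Fa m'F ->].
  rewrite mnm_setD mnm_set_mesym1 /D1 negb_or /in_interval /= subsetUl subUset GF /=.
  rewrite [_ \subset F](negbTE m'F) andbT.
  by apply: contra nG; apply: dD'; apply: subsetUl.
Qed.

(* The shelling of the boundary of a simplex: the proper subsets of F are
   sorted according to the first vertex that they miss. *)
Fixpoint boundary_shelling G (l : seq 'I_n) F :=
  if l is x :: l' then (G, F :\ x) :: boundary_shelling (x |: G) l' F else [::].

Lemma boundary_shelling_has G l F s :
  has (in_interval s) (boundary_shelling G l F) =
  [&& G \subset s, s \subset F & has (fun x => x \notin s) l].
Proof.
elim: l G => [|x l IH] G /=; first by rewrite !andbF.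
rewrite IH /in_interval /= subsetD1 subUset sub1set.
by case: (x \in s); case: (G \subset s); case: (s \subset F).
Qed.

Lemma boundary_shelling_mem G l F a : uniq l -> {in l, forall x, x \in F} ->
  {in l, forall x, x \notin G} -> G \subset F -> a \in boundary_shelling G l F ->
  [/\ G \subset a.1, a.1 \subset a.2 & #|a.2|.+1 = #|F|].
Proof.
elim: l G => //= x l IH G /andP[xl ul] lF lG GF; rewrite inE => /orP[/eqP->|] /=.
  split => //; first by rewrite subsetD1 GF lG // mem_head.
  by rewrite (cardsD1 x F) lF // mem_head.
case/IH => //.
- by move=> y yl; apply: lF; rewrite inE yl orbT.
- move=> y yl; rewrite !inE negb_or lG ?inE ?yl ?orbT // andbT.
  by apply: contraNneq xl => <-.
- by rewrite subUset sub1set GF lF ?mem_head.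
by move=> h ? ?; split=> //; apply: subset_trans h; apply: subsetUr.
Qed.

Lemma boundary_shelling_pairwise G l F : uniq l -> {in l, forall x, x \in F} ->
  {in l, forall x, x \notin G} -> G \subset F ->
  pairwise (fun a b : {set 'I_n} * {set 'I_n} => ~~ (b.1 \subset a.2)) (boundary_shelling G l F).
Proof.
elim: l G => //= x l IH G /andP[xl ul] lF lG GF.
have lF' : {in l, forall x, x \in F} by move=> y yl; apply: lF; rewrite inE yl orbT.
have lG' : {in l, forall y, y \notin x |: G}.
  move=> y yl; rewrite !inE negb_or lG ?inE ?yl ?orbT // andbT.
  by apply: contraNneq xl => <-.
have GF' : x |: G \subset F by rewrite subUset sub1set GF lF ?mem_head.
rewrite IH // andbT; apply/allP => b /(boundary_shelling_mem ul lF' lG' GF')[h _ _] /=.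
apply/negP => /(subset_trans h)/subsetP/(_ x).
by rewrite !inE eqxx => /(_ isT).
Qed.

Lemma regular_faces d : faces_regular d.
Proof.
elim: d => [|d IH] F cF.
  by have [_ h _] := face_prime F => /= sub; apply/h/sub.
have [iF _ pF] := face_prime F.
have iw : is_ideal whole by exact: monideal_ideal.
(* The monomial of [F] occurs in [e_(d+1)], which is therefore outside the prime ideal of [F]. *)
split=> [a _ /pF[|//] h|].
  have := h (mesym1 F); rewrite -[X in mesym _ _ X]cF mem_mesym1_mesym => /(_ isT).
  by rewrite mnm_set_mesym1 /face subxx.
(* In [k[F]] only the term of [F] survives in [e_(d+1)], so the quotient by it is the
   Stanley-Reisner ring of the boundary of the simplex [F]. *)
pose bd : pred {set 'I_n} := fun s => s \proper F.
have dbd : down_closed bd by move=> s t st tF; apply: sub_proper_trans tF.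
apply: (@regular_upto_iso _ true 1 whole (monideal bd)) => //.
- exact: add_mul_ideal.
- move=> a _; exists 0; first by apply: (ideal0 (add_mul_ideal _ iw iF)).
  by exists a => //; ring.
- move=> a _; rewrite mul1r; split.
    move=> [b Fb [c _ ->]]; apply: (idealD (monideal_ideal dbd)).
      by apply: monidealS Fb => s /proper_sub.
    rewrite mulrC; apply: (idealM _ (monideal_ideal dbd)).
    rewrite mesymE; apply: (ideal_sum _ (monideal_ideal dbd)) => h /eqP hd; apply/monidealX; rewrite mnm_set_mesym1.
    by apply/negP => /proper_card; rewrite hd cF ltnn.
  apply: monideal_ind; first exact: add_mul_ideal.
  move=> m; rewrite /bd properEneq negb_and negbK => h.
  have [mF|mF] := boolP (mnm_set m \subset F); last first.
    by apply: sub_add_mul => //; apply/monidealX.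
  move: h; rewrite mF orbF => /eqP mE.
  (* The other terms of [e_(d+1)] have supports not contained in [F]; they lie in the ideal of [F]
     and can be subtracted. *)
  exists ('X_[m - mesym1 F] * - (\sum_(h : {set 'I_n} | (#|h| == d.+1) && (h != F)) 'X_[mesym1 h])).
    apply: (idealM _ iF); rewrite -mulN1r; apply: (idealM _ iF); apply: (ideal_sum _ iF).
    move=> h /andP[/eqP hd hF]; apply/monidealX; rewrite mnm_set_mesym1 /face.
    by apply: contra hF => hF; rewrite eqEcard hF hd cF leqnn.
  exists 'X_[m - mesym1 F]; first by [].
  have Fm : F \subset mnm_set m by rewrite mE.
  have -> : 'X_[m] = 'X_[m - mesym1 F] * 'X_[mesym1 F] :> S.
    by rewrite -mpolyXD -mesym1_dvd.
  have -> : mesym n k d.+1 = 'X_[mesym1 F] +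
      \sum_(h : {set 'I_n} | (#|h| == d.+1) && (h != F)) 'X_[mesym1 h].
    by rewrite mesymE (bigD1 F) ?cF.
  by rewrite mulrDl mulrN addrCA [X in _ + (_ + X)]mulrC addNr addr0 mulrC.
have enF : {in enum F, forall x, x \in F} by move=> x; rewrite mem_enum.
have en0 : {in enum F, forall x, x \notin (set0 : {set 'I_n})} by move=> x _; rewrite inE.
have cbd a : a \in boundary_shelling set0 (enum F) F ->
    [/\ set0 \subset a.1, a.1 \subset a.2 & #|a.2|.+1 = #|F|].
  by apply: boundary_shelling_mem; rewrite ?enum_uniq ?sub0set.
(* The facets of the boundary have [d] vertices, so its shelling reduces the claim to [IH]. *)
have := @shelling_regular d pred0 bd (boundary_shelling set0 (enum F) F).
rewrite (_ : _ != [::]); last first.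
  by case E: (enum F) => //; move/eqP: cF; rewrite cardE E.
apply=> //.
- by move=> a /cbd[_ h]; rewrite cF => -[].
- by apply: boundary_shelling_pairwise; rewrite ?enum_uniq ?sub0set.
- move=> s; rewrite boundary_shelling_has sub0set /= /bd properE; congr (_ && _).
  apply/subsetPn/hasP => -[x]; first by move=> xF xs; exists x; rewrite ?mem_enum.
  by rewrite mem_enum => xF xs; exists x.
Qed.

End MonomialIdeals.

(** * Algebraic relations bound dimension and depth *)

Lemma exists_linear_relation (k : fieldType) (I : eqType) (r : seq I) (J : finType)
    (g : I -> J -> k) : uniq r -> (#|J| < size r)%N ->
  exists c : I -> k, (exists2 i, i \in r & c i != 0) /\
    forall j, \sum_(i <- r) c i * g i j = 0.
Proof.
move=> ur ltJ; case: r ur ltJ => [//|i0 r0]; set r := i0 :: r0 => ur ltJ.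
pose A := \matrix_(i < size r, j < #|J|) g (nth i0 r i) (enum_val j).
have : kermx A != 0.
  rewrite kermx_eq0; apply/negP => /eqP rA.
  by have := rank_leq_col A; rewrite rA leqNgt ltJ.
rewrite -nz_row_eq0; set v := nz_row _ => nzv.
have vA : v *m A = 0 by apply/sub_kermxP; exact: nz_row_sub.
pose c i := if insub (index i r) is Some j then v 0 j else 0.
have cE (j : 'I_(size r)) : c (nth i0 r j) = v 0 j by rewrite /c index_uniq // valK.
exists c; split.
  have [j vj] : exists j, v 0 j != 0.
    apply/existsP; apply: contraNT nzv => /existsPn v0; apply/eqP/rowP => j.
    by rewrite mxE; apply/eqP; rewrite -[_ == _]negbK.
  by exists (nth i0 r j); rewrite ?mem_nth ?cE.
move=> j; have /rowP/(_ (enum_rank j)) := vA; rewrite !mxE => e.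
rewrite -[RHS]e (big_nth i0) big_mkord; apply: eq_bigr => i _.
by rewrite cE !mxE enum_rankK.
Qed.

Section AlgebraicRelations.
Variables (k : fieldType) (n : nat).
Local Notation S := {mpoly k[n]}.
Implicit Types (f g : S) (fs : seq S) (F : {set 'I_n}).

(* [eval_poly fs c] is the value at fs of the polynomial whose coefficients
   (indexed by lists of exponents, all smaller than N) are given by c. *)
Fixpoint eval_poly N fs (c : seq 'I_N -> k) : S :=
  if fs is f :: fs' then \sum_(j < N) f ^+ j * eval_poly fs' (fun a => c (j :: a))
  else (c [::])%:MP.

Lemma eval_poly_eq0 N fs (c : seq 'I_N -> k) :
  (forall a, size a = size fs -> c a = 0) -> eval_poly fs c = 0.
Proof.
elim: fs c => [|f fs IH] c c0 /=; first by rewrite c0.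
by rewrite big1 // => j _; rewrite IH ?mulr0 // => a sa; apply: c0; rewrite /= sa.
Qed.

Fixpoint words N s : seq (seq 'I_N) :=
  if s is s'.+1 then [seq j :: a | j <- enum 'I_N, a <- words N s'] else [:: [::]].

Lemma words_uniq N s : uniq (words N s).
Proof.
elim: s => //= s IH; apply: allpairs_uniq; rewrite ?enum_uniq //.
by move=> [j a] [j' a'] _ _ /= [-> ->].
Qed.

Lemma size_words N s : size (words N s) = (N ^ s)%N.
Proof. by elim: s => //= s IH; rewrite size_allpairs IH size_enum_ord expnS. Qed.

Lemma mem_words N s a : a \in words N s -> size a = s.
Proof.
elim: s a => [|s IH] a /=; first by rewrite inE => /eqP->.
by case/allpairsP => -[j b] /= [_ /IH <- ->].
Qed.

Fixpoint power_product N fs (a : seq 'I_N) : S :=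
  match fs, a with
  | f :: fs', j :: a' => f ^+ j * power_product fs' a'
  | _, _ => 1
  end.

Lemma eval_polyE N fs (c : seq 'I_N -> k) :
  eval_poly fs c = \sum_(a <- words N (size fs)) c a *: power_product fs a.
Proof.
elim: fs c => [|f fs IH] c /=; first by rewrite big_seq1 /= alg_mpolyC.
rewrite big_allpairs_dep big_enum; apply: eq_bigr => j _ /=.
by rewrite IH mulr_sumr; apply: eq_bigr => a _; rewrite scalerAr.
Qed.

Definition deg_le d f := {in msupp f, forall m, (mdeg m <= d)%N}.

Lemma deg_leM d1 d2 f g : deg_le d1 f -> deg_le d2 g -> deg_le (d1 + d2) (f * g).
Proof.
move=> hf hg m /msuppM_le/allpairsP[[m1 m2] /= [m1f m2g ->]].
by rewrite mdegD leq_add ?hf ?hg.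
Qed.

Lemma deg_le1 d : deg_le d 1.
Proof. by move=> m; rewrite msupp1 inE => /eqP->; rewrite mdeg0. Qed.

Lemma deg_leX d f j : deg_le d f -> deg_le (j * d) (f ^+ j).
Proof.
move=> hf; elim: j => [|j IH]; first exact: deg_le1.
by rewrite exprS mulSn; apply: deg_leM.
Qed.

Lemma deg_le_power_product N d fs (a : seq 'I_N) : {in fs, forall f, deg_le d f} ->
  deg_le (size fs * (N * d)) (power_product fs a).
Proof.
elim: fs a => [|f fs IH] [|j a] hfs; try exact: deg_le1.
rewrite /= mulSn; apply: deg_leM; last by apply: IH => g gfs; apply: hfs; rewrite inE gfs orbT.
move=> m /(deg_leX (hfs f (mem_head _ _))) h.
by apply: leq_trans h _; rewrite leq_mul2r ltnW ?orbT.
Qed.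

Lemma deg_le_seq fs : exists d, {in fs, forall f, deg_le d f}.
Proof.
exists (\max_(f <- fs) msize f) => f ffs m mf.
apply: leq_trans (ltnW (msize_mdeg_lt mf)) _.
exact: leq_bigmax_seq.
Qed.

(* Counting argument: with N > |Fs| (s D + 1)^d there are N^s > N^d (N - 1)
   products of powers of fs with exponents smaller than N, and modulo the faces
   in Fs they live in a space of dimension at most |Fs| (s N D + 1)^d. *)
Lemma exists_algebraic_relation d (Fs : seq {set 'I_n}) fs :
  {in Fs, forall F, #|F| = d} -> (d < size fs)%N ->
  exists N (c : seq 'I_N -> k),
    (exists2 a, size a = size fs & c a != 0) /\
    {in Fs, forall F, monideal (face F) (eval_poly fs c)}.
Proof.
move=> cF ltd; have [D hD] := deg_le_seq fs.
set s := size fs in ltd *.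
(* With this choice |Fs| (s D + 1)^d < N, hence |Fs| (N (s D + 1))^d < N^(d+1) <= N^s. *)
pose N := (size Fs * (s * D).+1 ^ d).+1.
pose K := (s * (N * D))%N.
pose J := ('I_(size Fs) * {ffun 'I_d -> 'I_K.+1})%type.
(* The second component of [j] lists the exponents along the vertices of the chosen face, all others
   being 0; every monomial of degree at most [K] supported on a face of [Fs] is reached. *)
pose mon (j : J) : 'X_{1..n} :=
  [multinom (if insub (index x (enum (nth set0 Fs j.1))) is Some i then val (j.2 i) else 0%N) | x < n].
have [|c [[a aw ca] rel]] := @exists_linear_relation _ _ (words N s) J
  (fun a j => (power_product fs a)@_(mon j)) (words_uniq N s).
  rewrite card_prod card_ffun !card_ord size_words.
  have h1 : (K.+1 <= N * (s * D).+1)%N.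
    by rewrite /K mulnS mulnCA addnC -addn1 leq_add2l.
  apply: (@leq_ltn_trans (size Fs * (N ^ d * (s * D).+1 ^ d))%N).
    by rewrite leq_mul2l -expnMn; apply/orP; right; case: (d) => // d'; rewrite leq_exp2r.
  apply: (@leq_trans (N ^ d.+1)%N); last by rewrite leq_pexp2l.
  by rewrite mulnCA expnSr ltn_pmul2l ?expn_gt0 // ltnS.
exists N, c; split; first by exists a => //; apply: mem_words.
move=> F FFs m; rewrite mcoeff_msupp /face eval_polyE raddf_sum /=.
apply: contra => mF.
have [mK|Km] := leqP (mdeg m) K; last first.
  apply/eqP; rewrite big1 // => b _; rewrite mcoeffZ memN_msupp_eq0 ?mulr0 //.
  by apply/negP => /(deg_le_power_product hD); rewrite leqNgt Km.
have lF : (index F Fs < size Fs)%N by rewrite index_mem.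
pose g : {ffun 'I_d -> 'I_K.+1} := [ffun i : 'I_d => inord (nth 0%N [seq m x | x <- enum F] i)].
have mE : m = mon (Ordinal lF, g).
  apply/mnmP => x; rewrite mnmE /= nth_index //.
  have [xF|xF] := boolP (x \in F); last first.
    rewrite insubN; last by rewrite -leqNgt -(cF F FFs) cardE leqNgt index_mem mem_enum.
    have := contra (subsetP mF x) xF; rewrite inE negbK; exact: eqP.
  have lx : (index x (enum F) < d)%N by rewrite -(cF F FFs) cardE index_mem mem_enum.
  rewrite insubT /= ffunE /= (nth_map x) -?cardE ?cF // nth_index ?mem_enum // inordK //.
  rewrite ltnS; apply: leq_trans mK; rewrite mdegE (bigD1 x) //=; exact: leq_addr.
rewrite mE; apply/eqP; rewrite -[RHS](rel (Ordinal lF, g)); apply: eq_bigr => b _.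
by rewrite mcoeffZ.
Qed.

(* Abstracts two situations: K runs through the primes of a strict chain, or
   through the annihilators of the successive quotients by a regular sequence. *)
Inductive tower : (S -> Prop) -> seq S -> Prop :=
  | TowerNil (K : S -> Prop) : (forall c, c != 0 -> ~ K c%:MP) -> tower K [::]
  | TowerCons (K K' : S -> Prop) f fs : (forall u, K (f * u) -> K u) ->
      (forall u h, K (u + f * h) -> K' u) -> tower K' fs -> tower K (f :: fs).

(* Divide a relation by the lowest power of f that occurs in it, and reduce
   modulo f. *)
Lemma tower_free N (K : S -> Prop) fs (c : seq 'I_N -> k) :
  tower K fs -> K (eval_poly fs c) -> forall a, size a = size fs -> c a = 0.
Proof.
move=> tK; elim: tK c => {K fs} [K nK|K K' f fs cancel reduce _ IH] c /= Kc a sa.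
  case: a sa => // _; apply/eqP; apply: contraT => c0; case: (nK _ c0 Kc).
case: a sa => // j a [sa].
have [m] := ubnP (val j); elim: m => // m IHm in j a sa *; rewrite ltnS => jm.
pose g (i : 'I_N) := eval_poly fs (fun b => c (i :: b)).
have g0 (i : 'I_N) : (i < j)%N -> g i = 0.
  by move=> ij; apply: eval_poly_eq0 => b sb; apply: IHm => //; apply: leq_trans jm.
apply: (IH (fun b => c (j :: b))) => //.
(* What follows [g j] after division by [f ^+ j]: the term of index [i > j] keeps [f ^+ (i - j)],
   from which one factor [f] is split off, and the terms below [j] vanish. *)
apply: (reduce _ (\sum_(i < N | i != j) (if (i < j)%N then 0 else f ^+ (i - j).-1 * g i))).
have: forall e u, K (f ^+ e * u) -> K u.
  by elim=> [|e IHe] u; rewrite ?expr0 ?mul1r // exprS -mulrA => /cancel/IHe.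
move/(_ j); apply; rewrite -/(g j).
suff <- : \sum_(i < N) f ^+ i * g i =
    f ^+ j * (g j + f * (\sum_(i < N | i != j) (if (i < j)%N then 0 else f ^+ (i - j).-1 * g i))).
  exact: Kc.
rewrite (bigD1 j) //= mulrDr mulrA mulr_sumr; congr (_ + _).
apply: eq_bigr => i ij.
case: ltnP => [/g0->|ji]; first by rewrite !mulr0.
have {ij}ji : (j < i)%N by rewrite ltn_neqAle eq_sym ij.
rewrite !mulrA -exprSr -exprD; congr (f ^+ _ * _).
by rewrite addSnnS prednK ?subn_gt0 // subnKC // ltnW.
Qed.

Lemma tower_sizeP d (Fs : seq {set 'I_n}) (K : S -> Prop) fs :
  {in Fs, forall F, #|F| = d} ->
  (forall f, {in Fs, forall F, monideal (face F) f} -> K f) ->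
  tower K fs -> (size fs <= d)%N.
Proof.
move=> cF FK tK; rewrite leqNgt; apply/negP => ltd.
have [N [c [[a sa /eqP ca] rel]]] := exists_algebraic_relation cF ltd.
by apply: ca; apply: tower_free sa; [exact: tK|exact: FK].
Qed.

Lemma regular_tower (A B : S -> Prop) fs : is_ideal A -> is_ideal B ->
  regular_seq A B fs -> tower (annihilator A B) fs.
Proof.
move=> iA; elim: fs B => [|f fs IH] B iB /=.
  move=> h; apply: TowerNil => c c0 Kc; apply: h => a Aa.
  have -> : a = c^-1%:MP * (c%:MP * a) by rewrite mulrA -mpolyCM mulVf // mul1r.
  by apply: idealM => //; apply: Kc.
case=> reg /IH tw; apply: TowerCons (tw (add_mul_ideal _ iA iB)) => u.
  move=> Ku a Aa; apply: reg; first exact: idealM.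
  by rewrite mulrA; apply: Ku.
move=> h Kuh a Aa; exists ((u + f * h) * a); first exact: Kuh.
exists (- h * a); first exact: idealM.
by ring.
Qed.

End AlgebraicRelations.

(** * Shellable complexes are sequentially Cohen-Macaulay *)

Section SequentiallyCM.
Variables (k : fieldType) (n : nat).
Local Notation S := {mpoly k[n]}.
Local Notation interval := ({set 'I_n} * {set 'I_n})%type.
Implicit Types (a b : interval) (L : seq interval).

(** Each element is picked in one prime outside the preceding one; primality allows it to be
    cancelled. *)
Lemma prime_chain_tower e (p : nat -> S -> Prop) :
  (forall i, (i <= e)%N -> prime_ideal (p i)) ->
  (forall i, (i < e)%N -> strict_sub_ideal (p i) (p i.+1)) ->
  exists2 fs, size fs = e & tower (p 0%N) fs.
Proof.
elim: e p => [|e IH] p prp strp.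
  exists [::] => //; apply: TowerNil => c c0 pc.
  have [ip np1 _] := prp 0%N (leqnn _); apply: np1.
  have -> : 1 = c^-1%:MP * c%:MP :> S by rewrite -mpolyCM mulVf.
  exact: idealM.
have [fs sz tw] : exists2 fs, size fs = e & tower (p 1%N) fs.
  by apply: (IH (fun i => p i.+1)) => i ie; [apply: prp|apply: strp].
have [sub01 nsub] := strp 0%N isT.
have [f nf] := not_all_ex_not _ _ nsub.
have [p1f np0f] := imply_to_and _ _ nf.
have [_ _ prime0] := prp 0%N isT; have [i1 _ _] := prp 1%N isT.
exists (f :: fs); first by rewrite /= sz.
apply: TowerCons tw => [u /prime0[//|//]|u h /sub01 p1].
by apply: (@idealDr _ _ (f * h)) => //; [rewrite mulrC; apply: idealM|rewrite addrC].
Qed.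

(** The lower bounds come from a flag of faces below one top, giving a chain of primes, and from
    [esyms]; both upper bounds come from [tower_sizeP] applied to the tops in [L]. *)
Lemma shelling_cohen_macaulay d (D' D : pred {set 'I_n}) L :
  down_closed D' -> down_closed D -> L != [::] ->
  {in L, forall a : interval, [/\ a.1 \subset a.2, #|a.2| = d & ~~ D' a.1]} ->
  pairwise (fun a b : interval => ~~ (b.1 \subset a.2)) L ->
  (forall s, D s = D' s || has (in_interval s) L) ->
  strict_sub_ideal (monideal D) (monideal D' : S -> Prop) /\
  cohen_macaulay_of_dim (@irrelevant_ideal k n) (monideal D') (monideal D) d.
Proof.
move=> dD' dD Ln0 inL pw DE.
have iD' := @monideal_ideal k n D' dD'; have iD := @monideal_ideal k n D dD.
have DD' : sub_ideal (monideal D) (monideal D' : S -> Prop).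
  by apply: monidealS => s; rewrite !unfold_in DE => ->.
have [a0 a0L] : exists a, a \in L by case: (L) Ln0 => // a L' _; exists a; rewrite mem_head.
have [GF cF nG] := inL a0 a0L.
have DF : D a0.2 by rewrite DE; apply/orP; right; apply/hasP; exists a0; rewrite /in_interval ?GF ?subxx.
have nD'F : ~~ D' a0.2 by apply: contra nG; apply: dD'.
have cL : {in [seq a.2 | a <- L], forall F : {set 'I_n}, #|F| = d}.
  by move=> F /mapP[a /inL[_ h _] ->].
have killed (f : S) : {in [seq a.2 | a <- L], forall F, monideal (face F) f} ->
    annihilator (monideal D') (monideal D) f.
  move=> Ff u D'u m /msuppM_le/allpairsP[[m1 m2] /= [m1f m2u ->]].
  rewrite mnm_setD DE negb_or; apply/andP; split.
    by apply: contra (D'u _ m2u); apply: dD'; apply: subsetUr.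
  apply/hasPn => a aL; rewrite negb_and; apply/orP; right.
  have aF : a.2 \in [seq a.2 | a <- L] by apply: map_f.
  by apply: contra (Ff _ aF _ m1f); apply: subset_trans; apply: subsetUl.
(* Test [f] on the monomial of the top [a0.2], which belongs to the ideal of [D']. *)
have annF (f : S) : annihilator (monideal D') (monideal D) f -> monideal (face a0.2) f.
  move=> Af m mf; apply/negP => /= mF.
  have D'X : monideal D' ('X_[mesym1 a0.2] : S) by apply/monidealX; rewrite mnm_set_mesym1.
  have := Af _ D'X (mesym1 a0.2 + m)%MM.
  rewrite (perm_mem (msuppMX _ _)) map_f // => /(_ isT).
  rewrite mnm_setD mnm_set_mesym1 (_ : _ :|: _ = a0.2) ?DF //.
  by apply/setUidPl.
have nsub : ~ sub_ideal (monideal D') (monideal D : S -> Prop).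
  move/(_ 'X_[mesym1 a0.2]) => h.
  have /h/monidealX : monideal D' ('X_[mesym1 a0.2] : S) by apply/monidealX; rewrite mnm_set_mesym1.
  by rewrite mnm_set_mesym1 DF.
split; first by split.
split; split.
(* The faces shrink by one vertex at each step, from [d] vertices to none, so their prime ideals
   increase. *)
- pose F i := [set x in take (d - i) (enum a0.2)].
  have sF i : F i \subset a0.2.
    by apply/subsetP => x; rewrite inE => /mem_take; rewrite mem_enum.
  have FS i : F i.+1 \subset F i.
    apply/subsetP => x; rewrite !inE => h.
    by rewrite -(cat_take_drop (d - i.+1) (take _ _)) mem_cat take_takel ?h // leq_sub2l.
  have cFi i : #|F i| = (d - i)%N.
    rewrite cardsE (card_uniqP _) ?take_uniq ?enum_uniq // size_take -cardE cF.
    by case: ltngtP (leq_subr i d) => // ->.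
  exists (fun i => monideal (face (F i))); split=> i id.
    split; first exact: face_prime.
    by move=> f /annF; apply: monidealS => s /subset_trans; apply.
  split; first by apply: monidealS => s /subset_trans; apply.
  move/(_ 'X_[mesym1 (F i)]) => h.
  have /h/monidealX : monideal (face (F i.+1)) ('X_[mesym1 (F i)] : S).
    apply/monidealX; rewrite mnm_set_mesym1 /face; apply/negP => /subset_leq_card.
    by rewrite !cFi leqNgt ltn_sub2l.
  by rewrite mnm_set_mesym1 /face subxx.
- move=> e p [prp strp].
  have [fs <- tw] : exists2 fs, size fs = e & tower (p 0%N) fs.
    by apply: prime_chain_tower => // i /prp[].
  apply: tower_sizeP cL _ tw => f /killed; exact: (prp 0%N isT).2.
- exists (esyms k n d); split; [exact: esyms_irrelevant| |exact: size_esyms].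
  have := shelling_regular (@regular_faces k n d) dD' dD inL pw DE.
  by rewrite Ln0; apply: regular_uptoT.
- move=> fs _ /(regular_tower iD' iD); exact: tower_sizeP cL killed.
Qed.

Lemma shelling_sequentially_cm (D : pred {set 'I_n}) L :
  down_closed D -> shelling D L ->
  quotient_sequentially_cohen_macaulay (monideal D : S -> Prop).
Proof.
move=> dD [/allP subL pwL DE].
pose geD d s := has (fun a => (d <= #|a.2|)%N && in_interval s a) L.
(* By the shelling order, a subset of a face in one interval lies in an interval whose top is at
   least as large. *)
have dgeD d : down_closed (geD d).
  move=> s t st /hasP[a aL /and3P[da a1 a2]].
  have : D s by apply: dD st _; rewrite DE; apply/hasP; exists a; rewrite // /in_interval a1.
  rewrite DE => /hasP[b bL bs]; apply/hasP; exists b; rewrite // bs andbT.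
  apply: leq_trans da _; rewrite leqNgt; apply/negP => lt.
  case/negP: (pairwise_shell_lt pwL aL bL lt).
  by case/andP: bs => b1 _; apply: subset_trans b1 (subset_trans st a2).
have geDS d s : geD d s = geD d.+1 s || has (in_interval s) [seq a : interval <- L | #|a.2| == d].
  apply/hasP/orP => [[a aL /andP[da sa]]|[/hasP[a aL /andP[da sa]]|/hasP[a]]].
  - have [da'|da'] := boolP (#|a.2| == d).
      by right; apply/hasP; exists a; rewrite // mem_filter da'.
    by left; apply/hasP; exists a; rewrite // sa andbT ltn_neqAle eq_sym da'.
  - by exists a; rewrite // sa andbT ltnW.
  - by rewrite mem_filter => /andP[/eqP da aL] sa; exists a; rewrite // da leqnn.
(* Induction on the number [e] of sizes from [d] to [n]. Only the values of [D0] are prescribed, so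
   that an empty layer can be skipped without changing [J 0]. *)
suff filt e d D0 : (d + e)%N = n.+1 -> D0 =1 geD d ->
  exists (r : nat) (J : nat -> S -> Prop) (dm : nat -> nat),
    [/\ J 0%N = monideal D0, forall f, J r f, forall i, (i <= r)%N -> homogeneous_ideal (J i),
      forall i, (i < r)%N -> strict_sub_ideal (J i) (J i.+1) /\
          cohen_macaulay_of_dim (@irrelevant_ideal k n) (J i.+1) (J i) (dm i)
      & (forall i, (i < r)%N -> (d <= dm i)%N) /\
        forall i, (i.+1 < r)%N -> (dm i < dm i.+1)%N].
  have [|r [J [dm [J0 Jr Jh Jcm [_ dmlt]]]]] := filt n.+1 0%N D (add0n _).
    by move=> s; rewrite DE.
  by exists r, J, dm; split=> // f; rewrite J0.
elim: e d D0 => [|e IH] d D0 de D0E.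
  (* No top has [n + 1] vertices, so [D0] is empty and its ideal is the whole ring. *)
  exists 0%N, (fun=> monideal D0), (fun=> 0%N); split=> //.
    move=> f m _; rewrite D0E; apply/hasPn => a _; rewrite negb_and -ltnNge.
    by rewrite addn0 in de; rewrite de ltnS -[X in (_ <= X)%N]card_ord max_card.
  move=> i _; apply: monideal_homogeneous => s t st; rewrite !D0E; exact: dgeD st.
have dD0 : down_closed D0 by move=> s t st; rewrite !D0E; exact: dgeD st.
rewrite addnS -addSn in de.
(* An empty layer adds no step, as the inclusions must be strict. *)
have [L0|Ln0] := eqVneq [seq a : interval <- L | #|a.2| == d] [::].
  have [|r [J [dm [J0 Jr Jh Jcm [dmd dmlt]]]]] := IH d.+1 D0 de.
    by move=> s; rewrite D0E geDS L0 orbF.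
  by exists r, J, dm; split=> //; split=> // i /dmd/ltnW.
have [r [J [dm [J0 Jr Jh Jcm [dmd dmlt]]]]] := IH d.+1 (geD d.+1) de (fun=> erefl).
exists r.+1, (fun i => if i is i'.+1 then J i' else monideal D0),
  (fun i => if i is i'.+1 then dm i' else d).
split=> //.
- by case=> [_|i ir]; [exact: monideal_homogeneous|exact: Jh].
- case=> [_|i ir]; last exact: Jcm.
  rewrite J0; apply: (shelling_cohen_macaulay _ _ Ln0) => //.
  + move=> a; rewrite mem_filter => /andP[/eqP da aL]; split=> //; first exact: subL.
    apply/negP => /hasP[b bL /and3P[db _ ab]].
    by rewrite -da in db; case/negP: (pairwise_shell_lt pwL bL aL db).
  + have /(pairwise_filter (fun a : interval => #|a.2| == d)) := pwL.
    apply: (sub_in_pairwise (P := [pred a : interval | #|a.2| == d])); last exact: filter_all.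
    move=> a b; rewrite !inE => /eqP da /eqP db /andP[/implyP h _].
    by apply: h; rewrite da db.
  + by move=> s; rewrite D0E.
- split=> [[|i] ir //|[|i] ir]; [exact: ltnW (dmd _ ir)|exact: dmd|exact: dmlt].
Qed.

End SequentiallyCM.

(** * The path ideal as a Stanley-Reisner ideal *)

Lemma shelling_preimset (T T' : finType) (f : T -> T') (D : pred {set T}) L :
  bijective f -> shelling D L ->
  shelling (fun s : {set T'} => D (f @^-1: s)) [seq (f @: a.1, f @: a.2) | a : {set T} * {set T} <- L].
Proof.
move=> [g fK gK] [subL pwL DE].
have finj := can_inj fK.
have preK (A : {set T}) : f @^-1: (f @: A) = A by apply/setP => x; rewrite inE mem_imset.
have sub1 (A : {set T}) (s : {set T'}) : (f @: A \subset s) = (A \subset f @^-1: s).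
  exact: sub_imset_pre.
have subI (A B : {set T}) : (f @: A \subset f @: B) = (A \subset B) by rewrite sub1 preK.
have sub2 (B : {set T}) (s : {set T'}) : (s \subset f @: B) = (f @^-1: s \subset B).
  suff <- : f @: (f @^-1: s) = s by rewrite subI preK.
  by apply/setP => y; rewrite -[y]gK mem_imset // inE.
split.
- by rewrite all_map; apply: sub_all subL => a /=; rewrite subI.
- rewrite pairwise_map; apply: sub_pairwise pwL => a b /=.
  by rewrite /shell_rel /= !subI !card_imset.
- move=> s; rewrite DE has_map; apply: eq_has => a.
  by rewrite /preim /in_interval /= sub1 sub2.
Qed.

Section PathIdeal.
Variables (disp : Order.disp_t) (P : finPOrderType disp) (k : fieldType) (t : nat).

Definition path_sets : {set {set P}} :=
  [set [set x in tval p] | p : t.-tuple P & sorted (covers [set: P]) p].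

Definition path_free : pred {set 'I_#|P|} :=
  fun s => independent path_sets [set: P] (enum_rank @^-1: s).

Lemma path_free_down : down_closed path_free.
Proof.
move=> s s' ss' /andP[_ /forall_inP h]; apply/andP; split; first exact: subsetT.
by apply/forall_inP => e /h; apply: contra => /subset_trans; apply; apply: preimsetS.
Qed.

Lemma path_monomialE (p : seq P) : uniq p ->
  path_monomial k p = 'X_[mesym1 (enum_rank @: [set x in p])].
Proof.
move=> up; rewrite /path_monomial mprodXE; congr 'X_[_].
apply/mnmP => i; rewrite mnm_sumE mnmE.
rewrite -[i]enum_valK mem_imset; last exact: enum_rank_inj.
rewrite inE -(count_uniq_mem _ up) -sum1_count [RHS]big_mkcond.
apply: eq_bigr => x _; rewrite mnm1E (inj_eq enum_rank_inj).
by rewrite /=; case: (x == _).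
Qed.

Lemma path_uniq (p : seq P) : sorted (covers [set: P]) p -> uniq p.
Proof.
move=> sp; apply: (sorted_uniq (Order.POrderTheory.lt_trans) (Order.POrderTheory.ltxx)).
by apply: sub_sorted sp => x y /and4P[].
Qed.

(** Paths have no repetition, so a monomial is divisible by a path monomial exactly when its support
    contains the path. *)
Lemma path_idealE (f : {mpoly k[#|P|]}) : path_ideal P k t f <-> monideal path_free f.
Proof.
have iM := @monideal_ideal k _ _ path_free_down.
split=> [[m [a [g [gen ->]]]]|].
  apply: (ideal_sum _ iM) => i _; apply: (idealM _ iM).
  have [p [sz sp ->]] := gen i; rewrite path_monomialE ?path_uniq //.
  apply/monidealX; rewrite mnm_set_mesym1 negb_and; apply/orP; right.
  have szp : size p == t by apply/eqP.
  apply/forall_inPn; exists [set x in p].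
    by apply/imsetP; exists (Tuple szp) => //; rewrite inE.
  by rewrite negbK setIT -sub_imset_pre.
move: f; apply: monideal_ind; first exact: ideal_gen_ideal.
move=> m; rewrite negb_and subsetT /= => /forall_inPn[e /imsetP[p]].
rewrite inE => sp ->{e}; rewrite negbK setIT -sub_imset_pre => sub.
rewrite (mesym1_dvd sub) mpolyXD; apply: idealM; first exact: ideal_gen_ideal.
apply: ideal_gen_mem; exists (tval p); split=> //; first exact: size_tuple.
by rewrite path_monomialE ?path_uniq.
Qed.

End PathIdeal.

Theorem corollary4p7 (disp : Order.disp_t) (P : finPOrderType disp)
    (hP : forest_poset P) (k : fieldType) (t : nat) (ht : (2 <= t)%N) :
  quotient_sequentially_cohen_macaulay (path_ideal P k t).
Proof.
have [L shL] := independent_shelling (@path_sets_nest _ _ hP t) [set: P] (subxx _).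
(* The shelling on subsets of [P] is carried over to the indices of the variables. *)
have := shelling_preimset (@enum_rank_bij P) shL.
move/(shelling_sequentially_cm k (@path_free_down _ P t)).
case=> r [J [d [J0 h1 h2 h3 h4]]]; exists r, J, d; split=> // f.
by split=> [/J0/path_idealE|/path_idealE/J0].
Qed.
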